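(* Let $X$ be the Cantor space and let $h$ be a homeomorphism of $X$. Then the following are equivalent: (i) $h$ is p.p.m.; (ii) there is a partition of $X$ into clopen $h$-invariant spaces $X_0,X_1,\dots,X_m$ ($m\ge 0$, with $X_0$ allowed to be empty) such that $h$ is strongly periodic on $X_0$ and, writing $h_i$ for the restriction of $h$ to $X_i$, $(X_1,h_1),\dots,(X_m,h_m)$ are compact minimal systems such that $(X_i,h_i)_{1\le i\le m}$ is a Kakutani compatible tuple.
   Context: A homeomorphism $g$ of a Hausdorff space $X$ is minimal if $X\neq\emptyset$ and the only proper closed subset $K\subsetneq X$ with $gK\subseteq K$ is $K=\emptyset$. A compact minimal system $(X,g)$ is an infinite compact Hausdorff space $X$ with a minimal homeomorphism $g$ of $X$. The topological full group $\tau[g]$ is the group of all homeomorphisms $h$ of $X$ for which there is a locally constant $c:X\to\mathbb{Z}$ with $hx=g^{c(x)}x$ for all $x$. A homeomorphism $h$ of a compact Hausdorff space $X$ is piecewise a power of a minimal homeomorphism (p.p.m.) if $X=\emptyset$ or there is a minimal homeomorphism $g$ of $X$ with $h\in\tau[g]$. A homeomorphism $h$ is strongly periodic on a compact Hausdorff space $X_0$ if $G=\langle h\rangle$ is, i.e. there are finitely many distinct subgroups $K_1,\dots,K_n$ of finite index in $G$ such that for each $j$ the set of points with stabilizer conjugate to $K_j$ is clopen, and these sets partition $X_0$; equivalently, $h$ has finite order on $X_0$ and the fixed point set of each power of $h$ on $X_0$ is clopen. For a compact minimal system $(X,g)$ and nonempty clopen $Y\subseteq X$, the induced transformation $g_Y:Y\to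 Y$ is $g_Yx=g^tx$ with $t$ the least positive integer such that $g^tx\in Y$. Compact minimal systems $(X_1,g_1)$, $(X_2,g_2)$ are Kakutani equivalent if there are nonempty clopen $Y_i\subseteq X_i$ and a homeomorphism $\kappa:Y_1\to Y_2$ with $\kappa\circ(g_1)_{Y_1}=(g_2)_{Y_2}\circ\kappa$ (this is an equivalence relation). A tuple $(X_i,h_i)_{1\le i\le m}$ of compact minimal systems is Kakutani compatible if there are compact minimal systems $(X_1,g_1),\dots,(X_m,g_m)$, all in a single Kakutani equivalence class, such that $h_i\in\tau[g_i]$ for each $i$ (for $m=0$ the condition is vacuous). *)

(* Defs.v *)
From HB Require Import structures.
From mathcomp Require Import all_boot all_order all_algebra.
From mathcomp Require Import mathcomp_extra boolp classical_sets functions.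
From mathcomp Require Import cardinality reals topology cantor.
Set Implicit Arguments.
Unset Strict Implicit.
Unset Printing Implicit Defensive.

Local Open Scope classical_set_scope.

(* Homeomorphisms carry their inverse as data, so that the self-homeomorphisms
   of X form a groupType, with (f * g) x = f (g x). *)
Record homeo (X Y : topologicalType) := Homeo {
  homeo_fun :> X -> Y;
  homeo_inv : Y -> X;
  homeo_funK : cancel homeo_fun homeo_inv;
  homeo_invK : cancel homeo_inv homeo_fun;
  homeo_fun_continuous : continuous homeo_fun;
  homeo_inv_continuous : continuous homeo_inv
}.

Lemma homeoP (X Y : topologicalType) (f g : homeo X Y) :
  homeo_fun f =1 homeo_fun g -> f = g.
Proof.
case: f g => [f f' fK f'K cf cf'] [g g' gK g'K cg cg'] /= /funext fg.
rewrite -{}fg in gK g'K cg *.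
have ff' : f' = g'.
  by apply/funext => y; apply: (can_inj fK); rewrite f'K g'K.
rewrite -{}ff' in gK g'K cg' *.
by congr Homeo; exact: Prop_irrelevance.
Qed.

HB.instance Definition _ (X Y : topologicalType) := gen_eqMixin (homeo X Y).
HB.instance Definition _ (X Y : topologicalType) := gen_choiceMixin (homeo X Y).

Section HomeoGroup.
Variable X : topologicalType.

Lemma id_continuous : continuous (@id X).
Proof. by move=> x; exact: cvg_id. Qed.

Definition homeo_id : homeo X X :=
  @Homeo X X id id (fun=> erefl) (fun=> erefl)
    id_continuous id_continuous.

Definition homeo_inverse (f : homeo X X) : homeo X X :=
  Homeo (@homeo_invK _ _ f) (@homeo_funK _ _ f)
    (@homeo_inv_continuous _ _ f) (@homeo_fun_continuous _ _ f).

Lemma homeo_comp_continuous (f g : homeo X X) : continuous (f \o g).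
Proof. by move=> x; apply: continuous_comp; exact: homeo_fun_continuous. Qed.

Lemma homeo_comp_inv_continuous (f g : homeo X X) :
  continuous (homeo_inv g \o homeo_inv f).
Proof. by move=> x; apply: continuous_comp; exact: homeo_inv_continuous. Qed.

Definition homeo_comp (f g : homeo X X) : homeo X X :=
  Homeo (can_comp (@homeo_funK _ _ f) (@homeo_funK _ _ g))
    (can_comp (@homeo_invK _ _ g) (@homeo_invK _ _ f))
    (@homeo_comp_continuous f g) (@homeo_comp_inv_continuous f g).

Lemma homeo_compA : associative homeo_comp.
Proof. by move=> f g h; exact: homeoP. Qed.
Lemma homeo_comp1f : left_id homeo_id homeo_comp.
Proof. by move=> f; exact: homeoP. Qed.
Lemma homeo_compf1 : right_id homeo_id homeo_comp.
Proof. by move=> f; exact: homeoP. Qed.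
Lemma homeo_compVf : left_inverse homeo_id homeo_inverse homeo_comp.
Proof. by move=> f; apply: homeoP; exact: homeo_funK. Qed.
Lemma homeo_compfV : right_inverse homeo_id homeo_inverse homeo_comp.
Proof. by move=> f; apply: homeoP; exact: homeo_invK. Qed.

HB.instance Definition _ := isGroup.Build (homeo X X)
  homeo_compA homeo_comp1f homeo_compf1 homeo_compVf homeo_compfV.

End HomeoGroup.

Definition expgz (G : groupType) (g : G) (z : int) : G :=
  match z with Posz n => (g ^+ n)%g | Negz n => (g ^- n.+1)%g end.

Definition minimal (X : topologicalType) (g : homeo X X) : Prop :=
  [set: X] !=set0 /\
  forall K : set X, closed K -> K `<` [set: X] -> g @` K `<=` K -> K = set0.

Definition compact_minimal_system (X : topologicalType) (g : homeo X X) : Prop :=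
  [/\ infinite_set [set: X], compact [set: X], hausdorff_space X & minimal g].

Definition locally_constant (X : topologicalType) (T : Type) (c : X -> T) :=
  forall x : X, \forall y \near x, c y = c x.

Definition topological_full_group (X : topologicalType) (g : homeo X X) :
    set (homeo X X) :=
  [set h | exists2 c : X -> int,
    locally_constant c & forall x, h x = expgz g (c x) x].

Definition ppm (X : topologicalType) (h : homeo X X) : Prop :=
  [set: X] = set0 \/
  exists2 g : homeo X X, minimal g & topological_full_group g h.

Section Restriction.
Variables (X : topologicalType) (h : homeo X X) (A : set X).
Hypothesis hA : h @` A = A.

Lemma invariant_fun (x : A) : h (set_val x) \in A.
Proof.
have : (h @` A) (h (set_val x)) by exists (set_val x); first exact: set_valP.
by rewrite hA => /mem_set.
Qed.

Lemma invariant_inv (x : A) : homeo_inv h (set_val x) \in A.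
Proof.
have [_ Ah] : h @` A `<=` A /\ A `<=` h @` A by rewrite hA; split.
rewrite set_valE; case: (Ah _ (set_valP x)) => y /mem_set Ay <-.
by rewrite homeo_funK.
Qed.

Definition restr_fun (x : A) : A := SigSub (invariant_fun x).
Definition restr_inv (x : A) : A := SigSub (invariant_inv x).

Lemma restr_funK : cancel restr_fun restr_inv.
Proof. by move=> x; apply: val_inj => /=; exact: homeo_funK. Qed.

Lemma restr_invK : cancel restr_inv restr_fun.
Proof. by move=> x; apply: val_inj => /=; exact: homeo_invK. Qed.

Lemma restr_fun_continuous : continuous restr_fun.
Proof.
apply: continuous_comp_initial => x.
apply: (@continuous_comp _ _ _ set_val h); first exact: initial_continuous.
exact: homeo_fun_continuous.
Qed.

Lemma restr_inv_continuous : continuous restr_inv.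
Proof.
apply: continuous_comp_initial => x.
apply: (@continuous_comp _ _ _ set_val (homeo_inv h)).
  exact: initial_continuous.
exact: homeo_inv_continuous.
Qed.

Definition restr_homeo : homeo A A :=
  Homeo restr_funK restr_invK restr_fun_continuous restr_inv_continuous.

End Restriction.

Section StronglyPeriodic.
Variable X : topologicalType.
Implicit Types (G H K : set (homeo X X)) (h : homeo X X).

Definition cyclic_group h : set (homeo X X) := range (expgz h).

Definition is_subgroup G K : Prop := K `<=` G /\ group_closed [in K].

Definition finite_index G K : Prop :=
  finite_set [set [set (g * k)%g | k in K] | g in G].

Definition stabilizer G (x : X) : set (homeo X X) := [set g | G g /\ g x = x].

Definition conjugate_in G H K : Prop :=
  exists2 g, G g & H = [set (k ^ g)%g | k in K].

Definition strongly_periodic_group G : Prop :=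
  exists (n : nat) (K : 'I_n -> set (homeo X X)),
    let S j := [set x | conjugate_in G (stabilizer G x) (K j)] in
    [/\ injective K,
        forall j, is_subgroup G (K j) /\ finite_index G (K j),
        forall j, clopen (S j) &
        partition [set: 'I_n] S [set: X]].

Definition strongly_periodic h : Prop :=
  strongly_periodic_group (cyclic_group h).

End StronglyPeriodic.

Section Induced.
Variables (X : topologicalType) (g : homeo X X) (Y : set X).

Definition returns (x : Y) : pred nat :=
  fun t => (0 < t)%N && ((g ^+ t)%g (set_val x) \in Y).

Lemma return_in (x : Y) (ex : exists t, returns x t) :
  (g ^+ ex_minn ex)%g (set_val x) \in Y.
Proof. by case: ex_minnP => t /andP[]. Qed.

(* The induced transformation. The value on a point that never returns to Y is
   junk; in a compact minimal system every point of a nonempty clopen Y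
   returns. *)
Definition induced (x : Y) : Y :=
  match pselect (exists t, returns x t) with
  | left ex => SigSub (return_in ex)
  | right _ => x
  end.

End Induced.

Definition kakutani_equivalent (X1 X2 : topologicalType)
    (g1 : homeo X1 X1) (g2 : homeo X2 X2) : Prop :=
  exists (Y1 : set X1) (Y2 : set X2),
    [/\ clopen Y1, Y1 !=set0, clopen Y2, Y2 !=set0 &
        exists kappa : homeo Y1 Y2,
          kappa \o induced g1 (Y := Y1) = induced g2 (Y := Y2) \o kappa].

Definition kakutani_compatible (m : nat) (X : 'I_m -> topologicalType)
    (h : forall i, homeo (X i) (X i)) : Prop :=
  exists g : forall i, homeo (X i) (X i),
    [/\ forall i, compact_minimal_system (g i),
        forall i j, kakutani_equivalent (g i) (g j) &
        forall i, topological_full_group (g i) (h i)].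

(* Main.v *)
(* Say that k is locally a power of f at x if k = f^n near x for some n.

   (ii) => (i): let f be minimal on a clopen set W and k map a clopen set A,
   disjoint from W, into W. Composing f with the involution that exchanges A and
   kA via k gives a map that is minimal on the union of W and A and of which f,
   as well as k on A, is locally a power. Start from (X_1, g_1), or from an
   odometer on a small cylinder if m = 0. For each other j, glue Y_j to Y_1 by
   the Kakutani equivalence and then climb the finite tower of g_j over Y_j,
   attaching each level by g_j^-1; g_j, hence h, becomes locally a power of the
   new map on X_j. The periodic part is absorbed likewise: it is covered by
   finitely many clopen U with U, hU, ..., h^(p-1)U disjoint and h^p = id on U,
   and U embeds into any nonempty clopen set by prepending a finite word.

   (i) => (ii): let h be in the full group of the minimal g. Along an infinite
   h-orbit the exponents form an injective integer sequence with bounded steps,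
   hence come within bounded distance of every point of a half-line. So if K is
   closed, h-invariant and consists of infinite orbits, finitely many
   g-translates of K contain a half orbit of g, thus cover X, and K has interior.
   Therefore the minimal sets of h among the infinite orbits are clopen, and by
   compactness finitely many of them form the complement of the clopen periodic
   part. Induced transformations of g on them provide Kakutani compatibility. *)

Require Import Defs.
From mathcomp Require Import all_boot all_order all_algebra.
From mathcomp Require Import mathcomp_extra boolp classical_sets functions.
From mathcomp Require Import cardinality reals topology cantor.
From mathcomp Require Import finmap zify.
Set Implicit Arguments.
Unset Strict Implicit.
Unset Printing Implicit Defensive.

Local Open Scope classical_set_scope.

(** * Integer powers in a group *)

Lemma expgz_subn (G : groupType) (g : G) (m n : nat) :
  expgz g (m%:Z - n%:Z)%R = (g ^+ m * g ^- n)%g.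
Proof.
have [nm|mn] := leqP n m.
  have -> : (m%:Z - n%:Z)%R = Posz (m - n) by lia.
  by rewrite /= expgnFr.
have -> : (m%:Z - n%:Z)%R = Negz (n - m).-1 by lia.
rewrite /= prednK ?subn_gt0// expgnFr 1?ltnW// invgM invgK.
by [].
Qed.

Lemma expgzD (G : groupType) (g : G) (a b : int) :
  expgz g (a + b)%R = (expgz g a * expgz g b)%g.
Proof.
have int_subn (z : int) : exists m n : nat, z = (m%:Z - n%:Z)%R.
  by case: z => n; [exists n, 0 | exists 0, n.+1]; lia.
have [m [n ->]] := int_subn a; have [p [q ->]] := int_subn b.
have -> : (m%:Z - n%:Z + (p%:Z - q%:Z))%R = ((m + p)%:Z - (q + n)%:Z)%R by lia.
rewrite !expgz_subn !expgnDr invgM !mulgA; congr (_ * _)%g.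
rewrite -!mulgA; congr (_ * _)%g.
by apply: commuteV; apply/commuteX2/commute_refl.
Qed.

Lemma expgzN (G : groupType) (g : G) (a : int) :
  expgz g (- a)%R = (expgz g a)^-1%g.
Proof.
have h : (expgz g (- a)%R * expgz g a)%g = 1%g by rewrite -expgzD GRing.addNr.
by rewrite -[LHS]mulg1 -(mulgV (expgz g a)) mulgA h mul1g.
Qed.

Lemma expgzM (G : groupType) (g : G) (a b : int) :
  expgz g (a * b)%R = expgz (expgz g a) b.
Proof.
have pos (n : nat) : expgz g (a * n%:Z)%R = (expgz g a ^+ n)%g.
  elim: n => [|n IH]; first by rewrite GRing.mulr0.
  by rewrite expgS -IH -expgzD; congr expgz; lia.
case: b => n; first exact: pos.
by rewrite NegzE GRing.mulrN !expgzN pos.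
Qed.

(** * Germs of full group elements and extension of minimal homeomorphisms *)

Section Germ.
Variable X : topologicalType.
Implicit Types (f g h k : homeo X X) (x : X) (A B D K U W Y : set X).

Lemma homeo_injective (S T : topologicalType) (f : homeo S T) : injective f.
Proof. exact: can_inj (@homeo_funK _ _ f). Qed.

Lemma homeo_mulE f g x : (f * g)%g x = f (g x). Proof. by []. Qed.

Lemma homeoVK f x : (f^-1)%g (f x) = x.
Proof. exact: homeo_funK. Qed.

Lemma homeoKV f x : f ((f^-1)%g x) = x.
Proof. exact: homeo_invK. Qed.

Lemma expgzDE f (a b : int) x : expgz f (a + b)%R x = expgz f a (expgz f b x).
Proof. by rewrite expgzD. Qed.

Lemma expgSE f n x : (f ^+ n.+1)%g x = f ((f ^+ n)%g x).
Proof. by rewrite expgS. Qed.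

Lemma expgSrE f n x : (f ^+ n.+1)%g x = (f ^+ n)%g (f x).
Proof. by rewrite expgSr. Qed.

Lemma expgDE f m n x : (f ^+ (m + n))%g x = (f ^+ m)%g ((f ^+ n)%g x).
Proof. by rewrite expgnDr. Qed.

Lemma near_homeo f x (P : set X) :
  (\forall y \near f x, P y) -> \forall y \near x, P (f y).
Proof. by move=> ?; exact: homeo_fun_continuous. Qed.

Lemma open_preimage f A : open A -> open (f @^-1` A).
Proof. by move: A; apply/continuousP; exact: homeo_fun_continuous. Qed.

Lemma closed_preimage f A : closed A -> closed (f @^-1` A).
Proof. by move: A; apply/continuous_closedP; exact: homeo_fun_continuous. Qed.

Lemma clopen_preimage f A : clopen A -> clopen (f @^-1` A).
Proof. by case=> ? ?; split; [exact: open_preimage|exact: closed_preimage]. Qed.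

Lemma image_homeoE f A : f @` A = (f^-1)%g @^-1` A.
Proof.
apply/seteqP; split=> [_ [x Ax <-]|y Ay].
  by rewrite /preimage /mkset homeoVK.
by exists ((f^-1)%g y) => //; rewrite homeoKV.
Qed.

Lemma clopen_image f A : clopen A -> clopen (f @` A).
Proof. by rewrite image_homeoE; exact: clopen_preimage. Qed.

Lemma clopen_near A x : clopen A -> \forall y \near x, A y <-> A x.
Proof.
move=> [oA cA]; have [Ax|nAx] := pselect (A x).
  have : \near x, A x by apply: open_nbhs_nbhs.
  by apply: filterS => y.
have : \near x, (~` A) x by apply: open_nbhs_nbhs; split=> //; exact: closed_openC.
by apply: filterS => y.
Qed.

(* [germ f k x]: near [x], the homeomorphism [k] is a power of [f]; so [k] lies
   in the topological full group of [f] iff, up to uniqueness of exponents,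
   [germ f k x] for all [x]. *)
Definition germ f k x := exists n : int, \forall y \near x, k y = expgz f n y.

Lemma germ_near f k k' x : (\forall y \near x, k' y = k y) -> germ f k x ->
  germ f k' x.
Proof. by move=> e [n kn]; exists n; apply: filterS2 e kn => y ->. Qed.

Lemma germ_refl f x : germ f f x.
Proof. by exists 1%Z; apply: nearW. Qed.

Lemma germ1 f x : germ f 1%g x.
Proof. by exists 0%Z; apply: nearW. Qed.

Lemma germM f k k' x : germ f k' (k x) -> germ f k x -> germ f (k' * k)%g x.
Proof.
move=> [m /near_homeo hm] [n hn]; exists (m + n)%R.
by apply: filterS2 hm hn => y e1 e2; rewrite homeo_mulE e1 e2 expgzDE.
Qed.

Lemma germV f k x : germ f k x -> germ f (k^-1)%g (k x).
Proof.
move=> [n hn]; exists (- n)%R.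
have : \forall y \near (k^-1)%g (k x), k y = expgz f n y.
  by rewrite homeoVK.
move=> /near_homeo; apply: filterS => y; rewrite homeoKV => {2}->.
by rewrite expgzN homeoVK.
Qed.

Lemma germV_preimage f k x : germ f k ((k^-1)%g x) -> germ f (k^-1)%g x.
Proof. by move=> /germV; rewrite homeoKV. Qed.

Lemma germV_inv f k x : germ f (k^-1)%g (k x) -> germ f k x.
Proof. by move/germV; rewrite invgK homeoVK. Qed.

Lemma germX f k x n : (forall i, (i < n)%N -> germ f k ((k ^+ i)%g x)) ->
  germ f (k ^+ n)%g x.
Proof.
elim: n => [|n IH] hk; first exact: germ1.
by rewrite expgS; apply: germM; [exact: hk|apply: IH => i /ltnW /hk].
Qed.

(** Near [x], [k] is a power of [f]. Forward iterates stay in [D]; for a negative exponent, backward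
    invariance puts the preimage in [D], and the germ of the positive power there is inverted. The
    set [D] serves when [f] is a local power of [f'] on one component only. *)
Lemma germ_trans f f' k D x :
  (forall y, D y -> D (f y)) -> (forall y, D (f y) -> D y) ->
  (forall y, D y -> germ f' f y) -> D x -> germ f k x -> germ f' k x.
Proof.
move=> Df DVf f'f Dx [n].
have pos m y : D y -> D ((f ^+ m)%g y) /\ germ f' (f ^+ m)%g y.
  move=> Dy; have Dm i : D ((f ^+ i)%g y).
    by elim: i => // i IH; rewrite expgSE; exact: Df.
  by split => //; apply: germX => i _; exact/f'f.
have neg m y : D ((f ^+ m)%g y) -> D y.
  by elim: m => // m IH; rewrite expgSE => /DVf /IH.
case: n => m kn; apply: germ_near kn _; first by have [] := pos m x Dx.
apply: germV_preimage; apply: (pos m.+1 _ _).2; apply: (neg m.+1).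
by rewrite homeoKV.
Qed.

Lemma germ_transT f f' k x : (forall y, germ f' f y) -> germ f k x ->
  germ f' k x.
Proof. by move=> f'f; apply: (@germ_trans _ _ _ setT). Qed.

(** The maps are total functions whose values off [C] are ignored, which avoids subspaces. Extension
    by the identity is continuous because membership in a clopen set is locally constant. *)
Lemma glue_homeo C (u v : X -> X) : clopen C ->
  (forall x, C x -> C (u x)) -> (forall x, C x -> C (v x)) ->
  (forall x, C x -> v (u x) = x) -> (forall x, C x -> u (v x) = x) ->
  (forall x, C x -> {for x, continuous u}) ->
  (forall x, C x -> {for x, continuous v}) ->
  exists s : homeo X X, [/\ forall x, C x -> s x = u x,
    forall x, C x -> (s^-1)%g x = v x & forall x, ~ C x -> s x = x].
Proof.
move=> cC Cu Cv vu uv cu cv.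
pose ext (w : X -> X) x := if pselect (C x) then w x else x.
have extC w x : C x -> ext w x = w x by rewrite /ext; case: pselect.
have extN w x : ~ C x -> ext w x = x by rewrite /ext; case: pselect.
have extK w w' : (forall x, C x -> C (w x)) ->
    (forall x, C x -> w' (w x) = x) -> cancel (ext w) (ext w').
  move=> Cw w'w x; have [Cx|nCx] := pselect (C x); last by rewrite !extN.
  by rewrite (extC w)// extC ?w'w//; exact: Cw.
have ext_cont w : (forall x, C x -> {for x, continuous w}) ->
    continuous (ext w).
  move=> cw x P; have nC := clopen_near x cC.
  have [Cx|nCx] := pselect (C x).
    rewrite extC// => /(cw _ Cx) Pw; change (\forall y \near x, P (ext w y)).
    apply: filterS2 nC Pw => y yC /= Pwy.
    by rewrite extC//; apply/yC.
  rewrite extN// => Px; change (\forall y \near x, P (ext w y)).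
  by apply: filterS2 nC Px => y yC /= Py; rewrite extN// => /yC.
exists (Homeo (extK _ _ Cu vu) (extK _ _ Cv uv) (ext_cont _ cu) (ext_cont _ cv)).
by split=> x Cx; [exact: extC|exact: extC|exact: extN].
Qed.

(** On the union of [A] and [B], the two maps combine into one that is its own inverse, so
    [glue_homeo] applies with this map on both sides. *)
Lemma swap_maps A B (u v : X -> X) : clopen A -> clopen B -> A `&` B = set0 ->
  (forall x, A x -> B (u x)) -> (forall x, B x -> A (v x)) ->
  (forall x, A x -> v (u x) = x) -> (forall x, B x -> u (v x) = x) ->
  (forall x, A x -> {for x, continuous u}) ->
  (forall x, B x -> {for x, continuous v}) ->
  exists s : homeo X X, [/\ forall x, A x -> s x = u x,
    forall x, B x -> s x = v x & forall x, ~ A x -> ~ B x -> s x = x].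
Proof.
move=> cA cB AB uB vA vu uv cu cv.
pose w x := if pselect (A x) then u x else v x.
have BNA x : B x -> ~ A x.
  by move=> Bx Ax; suff : (A `&` B) x by rewrite AB.
have wA x : A x -> w x = u x by rewrite /w; case: pselect.
have wB x : B x -> w x = v x by move/BNA; rewrite /w; case: pselect.
have ww x : (A `|` B) x -> w (w x) = x.
  case=> [Ax|Bx]; first by rewrite (wA x)// wB ?vu//; exact: uB.
  by rewrite (wB x)// wA ?uv//; exact: vA.
have Cw x : (A `|` B) x -> (A `|` B) (w x).
  case=> [Ax|Bx]; first by rewrite wA//; right; exact: uB.
  by rewrite wB//; left; exact: vA.
have cw x : (A `|` B) x -> {for x, continuous w}.
  case=> [Ax|Bx] P.
    rewrite wA// => /(cu _ Ax) Px; change (\forall y \near x, P (w y)).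
    by apply: filterS2 (clopen_near x cA) Px => y yA /=; rewrite wA//; apply/yA.
  rewrite wB// => /(cv _ Bx) Px; change (\forall y \near x, P (w y)).
  by apply: filterS2 (clopen_near x cB) Px => y yB /=; rewrite wB//; apply/yB.
have [s [sC _ sN]] := glue_homeo (clopenU cA cB) Cw Cw ww ww cw cw.
exists s; split=> x.
- by move=> Ax; rewrite sC ?wA//; left.
- by move=> Bx; rewrite sC ?wB//; right.
- by move=> nA nB; rewrite sN// => -[].
Qed.

Lemma swap_homeo A k : clopen A -> A `&` k @` A = set0 ->
  exists s : homeo X X, [/\ forall x, A x -> s x = k x,
    forall x, A x -> s (k x) = x &
    forall x, ~ A x -> ~ (k @` A) x -> s x = x].
Proof.
move=> cA Ak.
have [||||||s [sA skA sN]] :=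
  @swap_maps A (k @` A) k (k^-1)%g cA (clopen_image k cA) Ak.
- by move=> x Ax; exists x.
- by move=> _ [x Ax <-]; rewrite homeoVK.
- by move=> x _; exact: homeoVK.
- by move=> x _; exact: homeoKV.
- by move=> x _; exact: homeo_fun_continuous.
- by move=> x _; exact: homeo_fun_continuous.
by exists s; split=> // x Ax; rewrite skA ?homeoVK//; exists x.
Qed.

(** A minimal system on a clopen part, encoded as a homeomorphism of the whole space that is trivial
    elsewhere. All stages of the construction thus lie in one group and can be composed and compared
    by germs. *)
Definition minimal_on f W := [/\ clopen W, W !=set0,
  forall x, ~ W x -> f x = x &
  forall K, closed K -> K `<=` W -> K !=set0 -> f @` K `<=` K -> K = W].

Lemma minimal_on_fun f W x : minimal_on f W -> W x -> W (f x).
Proof.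
move=> [_ _ fN _] Wx; apply: contrapT => nW.
by have /homeo_injective fx := fN _ nW; rewrite fx in nW.
Qed.

Lemma minimal_on_inv f W x : minimal_on f W -> W (f x) -> W x.
Proof.
move=> [_ _ fN _] Wfx; apply: contrapT => nW.
by rewrite fN in Wfx.
Qed.

(* Every orbit passing through [k a] is made to visit [a] just before leaving
   [k a], so that [k] becomes the inverse of the new map on [A]. *)
Lemma minimal_on_extend f W A k : minimal_on f W -> clopen A ->
  W `&` A = set0 -> k @` A `<=` W ->
  exists f', [/\ minimal_on f' (W `|` A), forall x, germ f' f x &
    forall x, A x -> germ f' k x].
Proof.
move=> mf; have [cW W0 fN fK] := mf; move=> cA WA kA.
have nAW x : A x -> ~ W x.
  by move=> Ax Wx; suff : (W `&` A) x by rewrite WA.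
have AkA : A `&` k @` A = set0.
  apply/seteqP; split=> // x [Ax kAx]; exact: nAW (kA _ kAx).
have [s [sA skA sN]] := swap_homeo cA AkA.
pose f' := (f * s)%g.
have f'N x : ~ A x -> ~ (k @` A) x -> f' x = f x.
  by move=> nA nkA; rewrite homeo_mulE sN.
have f'A x : A x -> f' x = f (k x) by move=> Ax; rewrite homeo_mulE sA.
have f'kA x : A x -> f' (k x) = x.
  by move=> Ax; rewrite homeo_mulE skA// fN//; exact: nAW.
have f'2 x : A x -> f' (f' (k x)) = f (k x).
  by move=> Ax; rewrite f'kA// f'A.
exists f'; split.
- split.
  + exact: clopenU.
  + by case: W0 => w Ww; exists w; left.
  + move=> x nWA; rewrite f'N ?fN//; first by move=> Wx; apply: nWA; left.
    * by move=> Ax; apply: nWA; right.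
    * by move=> kAx; apply: nWA; left; exact: kA.
  + move=> K clK KWA [x0 Kx0] f'K.
    have f'Kx x : K x -> K (f' x) by move=> Kx; apply: f'K; exists x.
    (* On [W], the old map [f] is [f'] off [k @] A[, and]f'[applied twice on]k @[A], where the orbit
       makes its detour through [A]. So [f']-invariance of [K] gives [f]-invariance of its trace on
       [W]. *)
    have KW : K `&` W = W.
      apply: fK; [by apply: closedI => //; case: cW|by move=> x []| |].
      * have [Wx0|Ax0] := KWA _ Kx0; first by exists x0.
        exists (f' x0); split; first exact: f'Kx.
        by rewrite f'A//; apply: minimal_on_fun mf _; apply: kA; exists x0.
      * move=> _ [x [Kx Wx] <-]; split; last exact: minimal_on_fun mf Wx.
        have [[y Ay yx]|nkA] := pselect ((k @` A) x).
          by subst x; rewrite -f'2//; exact/f'Kx/f'Kx.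
        by rewrite -f'N//; [exact: f'Kx|move/nAW].
    apply/seteqP; split=> // x [Wx|Ax]; first by rewrite -KW in Wx; case: Wx.
    rewrite -(f'kA _ Ax); apply: f'Kx.
    have : W (k x) by apply: kA; exists x.
    by rewrite -KW => -[].
- move=> x; have nA := clopen_near x cA.
  have nkA := clopen_near x (clopen_image k cA).
  have [kAx|nkAx] := pselect ((k @` A) x).
    apply: (@germ_near _ (f' * f')%g).
      apply: filterS nkA => y /iffRL /(_ kAx) [z Az <-].
      by rewrite homeo_mulE f'2.
    by apply: germM; exact: germ_refl.
  have [Ax|nAx] := pselect (A x).
    apply: (@germ_near _ 1%g); last exact: germ1.
    apply: filterS nA => y /iffRL /(_ Ax) Ay.
    by rewrite fN//; exact: nAW.
  apply: (@germ_near _ f'); last exact: germ_refl.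
  apply: filterS2 nA nkA => y yA ykA.
  by rewrite f'N// => [/yA|/ykA].
- move=> x Ax; apply: germV_inv; apply: (@germ_near _ f'); last exact: germ_refl.
  have := near_homeo (f := (k^-1)%g) (x := k x) (P := fun y => A y <-> A x).
  rewrite homeoVK => /(_ (clopen_near x cA)); apply: filterS => y yA.
  by rewrite -[in f' y](homeoKV k y) f'kA//; apply/yA.
Qed.

End Germ.

(** * Towers and first returns *)

Section Tower.
Variable X : topologicalType.
Implicit Types (f g h k : homeo X X) (x : X) (A B D K U W Y : set X).

(** The levels may overlap: this is not a Rokhlin tower with disjoint floors, and a point may have
    several representations. *)
Definition tower g Y N :=
  [set x | exists2 s, (s <= N)%N & exists2 y, Y y & x = (g ^+ s)%g y].

Lemma tower0 g Y : tower g Y 0 = Y.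
Proof.
apply/seteqP; split=> [x [s] | x Yx]; last by exists 0 => //; exists x.
by rewrite leqn0 => /eqP -> [y Yy ->].
Qed.

Lemma towerS g Y N : tower g Y N.+1 = tower g Y N `|` (g ^+ N.+1)%g @` Y.
Proof.
apply/seteqP; split=> x.
- case=> s; rewrite leq_eqVlt => /predU1P[->|sN] [y Yy ->].
    by right; exists y.
  by left; exists s => //; exists y.
- case=> [[s sN [y Yy ->]]|[y Yy <-]]; last by exists N.+1 => //; exists y.
  by exists s; [exact: leqW|exists y].
Qed.

Lemma sub_tower g Y N : Y `<=` tower g Y N.
Proof. by move=> y Yy; exists 0 => //; exists y. Qed.

Lemma clopen_tower g Y N : clopen Y -> clopen (tower g Y N).
Proof.
move=> cY; elim: N => [|N IH]; first by rewrite tower0.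
by rewrite towerS; apply: clopenU => //; exact: clopen_image.
Qed.

(** Induction on the height: the part of the next level not yet absorbed is attached by [g^-1],
    which sends it one level down. Since the tower meets [W] only in [Y], every point outside [Y] is
    attached at the first level that reaches it. *)
Lemma minimal_on_tower f W g Y N : minimal_on f W -> clopen Y -> Y `<=` W ->
  (forall x, tower g Y N x -> W x -> Y x) ->
  exists f', [/\ minimal_on f' (W `|` tower g Y N), forall x, germ f' f x &
    forall x, tower g Y N x -> ~ Y x -> germ f' (g^-1)%g x].
Proof.
move=> mf cY YW; elim: N => [|N IH] WY.
  exists f; rewrite tower0; split=> //; last exact: germ_refl.
  by have -> : W `|` Y = W by exact/setUidPl.
have sub : tower g Y N `<=` tower g Y N.+1 by rewrite towerS => x; left.
have [f1 [mf1 f1f f1g]] := IH (fun x Tx => WY x (sub x Tx)).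
pose A := tower g Y N.+1 `&` ~` (W `|` tower g Y N).
have cA : clopen A.
  apply: clopenI; first exact: clopen_tower.
  by apply: clopenC; [exact: set0|case: mf1].
have [||f2 [mf2 f2f1 f2g]] := minimal_on_extend (k := (g^-1)%g) mf1 cA.
- by apply/seteqP; split=> // x [? [_]].
- move=> _ [x [[s sN [y Yy ->]] nWT] <-]; right.
  case: s sN nWT => [|s] sN nWT.
    by case: nWT; left; exact: YW.
  by exists s => //; exists y => //; rewrite expgSE homeoVK.
exists f2; split.
- have -> : W `|` tower g Y N.+1 = W `|` tower g Y N `|` A; last by [].
  apply/seteqP; split=> x.
    case=> [Wx|Tx]; first by left; left.
    by have [|nWT] := pselect ((W `|` tower g Y N) x); [left|right].
  by case=> [[Wx|/sub]|[]]; [left|right|right].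
- by move=> x; exact: germ_transT (f1f x).
- move=> x Tx nYx.
  have [TNx|nTNx] := pselect (tower g Y N x).
    by apply: germ_transT => //; exact: f1g.
  by apply: f2g; split=> // -[/(WY _ Tx)|].
Qed.

Lemma minimal_on_attach f W g Y N k : minimal_on f W -> clopen Y ->
  W `&` tower g Y N = set0 -> k @` Y `<=` W ->
  exists f', [/\ minimal_on f' (W `|` tower g Y N), forall x, germ f' f x,
    forall x, Y x -> germ f' k x &
    forall x, tower g Y N x -> ~ Y x -> germ f' (g^-1)%g x].
Proof.
move=> mf cY WT kY.
have WY : W `&` Y = set0.
  apply/seteqP; split=> // x [Wx Yx]; rewrite -WT; split=> //.
  exact: sub_tower.
have [f1 [mf1 f1f f1k]] := minimal_on_extend mf cY WY kY.
have [||f2 [mf2 f2f1 f2g]] := minimal_on_tower (g := g) (N := N) mf1 cY.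
- by move=> x; right.
- move=> x Tx [Wx|//].
  by suff : (W `&` tower g Y N) x by rewrite WT.
exists f2; split=> //.
- rewrite -setUA in mf2; suff <- : Y `|` tower g Y N = tower g Y N by [].
  by apply/setUidPr; exact: sub_tower.
- by move=> x; exact: germ_transT.
- by move=> x Yx; apply: germ_transT => //; exact: f1k.
Qed.

(** As levels of a tower may overlap, a representation from the last visit to [Y] has to be
    selected; an intermediate visit gives a new start with a smaller time. *)
Lemma last_visit g Y y s : Y y -> exists r, exists y', [/\ (r <= s)%N, Y y',
  (g ^+ s)%g y = (g ^+ r)%g y' &
  forall i, (0 < i)%N -> (i <= r)%N -> ~ Y ((g ^+ i)%g y')].
Proof.
elim/ltn_ind: s y => s IH y Yy.
have [[i [i0 is_ Yi]]|no] :=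
  pselect (exists i, [/\ (0 < i)%N, (i <= s)%N & Y ((g ^+ i)%g y)]).
  have [|r [y' [rs Yy' e nov]]] := IH (s - i)%N _ _ Yi; first by lia.
  exists r, y'; split=> //; first by lia.
  by rewrite -e -expgDE subnK.
exists s, y; split=> // i i0 is_ Yi; apply: no.
by exists i.
Qed.

Definition first_return g Y (t : nat) y := [/\ (0 < t)%N, Y ((g ^+ t)%g y) &
  forall i, (0 < i)%N -> (i < t)%N -> ~ Y ((g ^+ i)%g y)].

(* From [x] go back to the last visit to [Y], then forward to the first return. *)
Lemma germ_tower f g Y N :
  (forall x, tower g Y N x -> tower g Y N (g x)) ->
  (forall x, tower g Y N x -> ~ Y x -> germ f (g^-1)%g x) ->
  (forall y t, Y y -> first_return g Y t y -> germ f (g ^+ t)%g y) ->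
  forall x, tower g Y N x -> germ f g x.
Proof.
move=> gT fV ft x Tx; have [Ygx|nYgx] := pselect (Y (g x)); last first.
  by apply: germV_inv; apply: fV => //; exact: gT.
case: Tx => s sN [y0 /(last_visit g s) [r [y [rs Yy -> nov]]] xy].
rewrite {}xy in Ygx *.
have fVr : germ f ((g^-1) ^+ r)%g ((g ^+ r)%g y).
  have back i : (i <= r)%N -> ((g^-1) ^+ i)%g ((g ^+ r)%g y) = (g ^+ (r - i))%g y.
    elim: i => [|i IH] ir; first by rewrite subn0.
    rewrite expgSE IH ?(ltnW ir)//.
    by rewrite -[(r - i)%N]prednK ?subn_gt0// expgSE homeoVK subnS.
  apply: germX => i ir; rewrite back ?(ltnW ir)//; apply: fV.
    by exists (r - i)%N; [lia|exists y].
  by apply: nov; lia.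
have ret : first_return g Y r.+1 y.
  by split=> //; rewrite expgSE.
suff : germ f (g ^+ r.+1 * (g^-1) ^+ r)%g ((g ^+ r)%g y).
  by rewrite expVgn expgS -mulgA mulgV mulg1.
apply: germM => //.
suff -> : ((g^-1) ^+ r)%g ((g ^+ r)%g y) = y by exact: ft.
by rewrite expVgn homeoVK.
Qed.

Lemma first_return_uniq g Y t t' y :
  first_return g Y t y -> first_return g Y t' y -> t = t'.
Proof.
move=> [t0 Yt nt] [t'0 Yt' nt'].
have [lt_t|lt_t|//] := ltngtP t t'.
  by case: (nt' _ t0 lt_t Yt).
by case: (nt _ t'0 lt_t Yt').
Qed.

(** Return times are locally constant, since a first return at time [t] is decided by finitely many
    iterates and [Y] is clopen. *)
Lemma near_first_return g Y t y : clopen Y -> first_return g Y t y ->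
  \forall z \near y, first_return g Y t z.
Proof.
move=> cY [t0 Yt nov].
have novn : \forall z \near y, forall i, (i < t)%N -> (0 < i)%N ->
    ~ Y ((g ^+ i)%g z).
  elim: t {t0 Yt} nov => [|t IH] nov; first exact: nearW.
  have hi : \forall z \near y, (0 < t)%N -> ~ Y ((g ^+ t)%g z).
    case: (posnP t) => [-> | t0]; first exact: nearW.
    apply: filterS (near_homeo (clopen_near ((g ^+ t)%g y) cY)) => z zY _ /zY.
    exact: nov.
  apply: filterS2 hi (IH _) => [z zt zi i|i i0 it]; last exact/nov/leqW.
  by rewrite ltnS leq_eqVlt => /predU1P[->|/zi].
apply: filterS2 novn (near_homeo (clopen_near ((g ^+ t)%g y) cY)) => z zi zY.
by split=> // [|i i0 it]; [exact/zY|exact: zi].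
Qed.

Section PeriodicTower.
Variables (h : homeo X X) (A : set X) (p : nat).
Hypotheses (cA : clopen A) (p0 : (0 < p)%N).
Hypothesis hp : forall x, A x -> (h ^+ p)%g x = x.
Hypothesis Ap : forall x i, A x -> (0 < i)%N -> (i < p)%N -> ~ A ((h ^+ i)%g x).

(** Level [p] is level 0 again, so the tower closes up in both directions. *)
Lemma periodic_tower_invariant x : tower h A p (h x) <-> tower h A p x.
Proof.
split=> -[s sp [y Ay e]].
  case: s sp e => [|s] sp e.
    exists p.-1; first exact: leq_pred.
    exists y => //; apply: (@homeo_injective _ _ h).
    by rewrite -expgSE prednK// hp.
  exists s; first exact: ltnW.
  by exists y => //; apply: (@homeo_injective _ _ h); rewrite -expgSE.
rewrite {}e; move: sp; rewrite leq_eqVlt => /predU1P[->|sp].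
  by exists 1 => //; exists y => //; rewrite hp.
by exists s.+1 => //; exists y => //; rewrite expgSE.
Qed.

(** The first return time to [A] is constantly [p], and the return map is the identity, which is a
    power of any [f]. *)
Lemma germ_periodic_tower f :
  (forall x, tower h A p x -> ~ A x -> germ f (h^-1)%g x) ->
  forall x, tower h A p x -> germ f h x.
Proof.
move=> fh; apply: germ_tower => // [x /periodic_tower_invariant //|].
move=> y t Ay [t0 At nov].
have tp : t = p.
  have [lt_t|lt_t|//] := ltngtP t p; first by case: (Ap Ay t0 lt_t).
  by case: (nov p p0 lt_t); rewrite hp.
rewrite tp; apply: (@germ_near _ _ 1%g); last exact: germ1.
by apply: filterS (clopen_near y cA) => z /iffRL /(_ Ay) /hp.
Qed.

End PeriodicTower.

(* [W] absorbs the [h]-orbits of the part of [U] that it misses. *)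
Lemma minimal_on_periodic f W h U p k : minimal_on f W ->
  (forall x, W (h x) <-> W x) -> (forall x, W x -> germ f h x) ->
  clopen U -> (0 < p)%N -> (forall x, U x -> (h ^+ p)%g x = x) ->
  (forall x i, U x -> (0 < i)%N -> (i < p)%N -> ~ U ((h ^+ i)%g x)) ->
  k @` (U `&` ~` W) `<=` W ->
  exists f' W', [/\ minimal_on f' W', W `<=` W', U `<=` W',
    forall x, W' (h x) <-> W' x & forall x, W' x -> germ f' h x].
Proof.
move=> mf hW fh cU p0 hp Up kA; set A := U `&` ~` W in kA.
have cA : clopen A.
  by apply: clopenI => //; apply: clopenC; [exact: set0|case: mf].
have hWn n x : W ((h ^+ n)%g x) <-> W x.
  by elim: n => // n IH; rewrite expgSE hW.
have hpA x : A x -> (h ^+ p)%g x = x by case=> /hp.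
have Ap x i : A x -> (0 < i)%N -> (i < p)%N -> ~ A ((h ^+ i)%g x).
  by move=> [Ux _] i0 ip [/(Up _ _ Ux i0 ip)].
have WT : W `&` tower h A p = set0.
  apply/seteqP; split=> // x [Wx [s _ [y [_ nWy] xy]]].
  by move: Wx; rewrite xy hWn.
have [f' [mf' f'f f'k f'h]] := minimal_on_attach (k := k) mf cA WT kA.
exists f', (W `|` tower h A p); split; first exact: mf'.
- by move=> x; left.
- move=> x Ux; have [|nWx] := pselect (W x); [by left|right].
  exact: sub_tower.
- move=> x; have hT := periodic_tower_invariant p0 hpA x.
  by split=> [[/hW|/hT]|[/hW|/hT]] ?; [left|right|left|right].
- move=> x [Wx|]; first by apply: (@germ_transT _ f) => //; exact: fh.
  exact: germ_periodic_tower.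
Qed.

End Tower.

(** * The Cantor space and its odometer *)

Section Cantor.
Local Notation C := cantor_space.
Implicit Types (x y z : C) (U W : set C).

Definition cylinder x n : set C := [set y | forall i, (i < n)%N -> y i = x i].

Lemma near_coord x i : \forall y \near x, y i = x i.
Proof.
have := @proj_continuous nat (fun=> bool) i x.
move=> /(_ [set x i]); apply; apply: open_nbhs_nbhs; split=> //.
exact: discrete_open.
Qed.

Lemma near_cylinder x n : \forall y \near x, cylinder x n y.
Proof.
elim: n => [|n IH]; first by apply: (@filterE _ (nbhs x)) => y i.
apply: filterS2 IH (near_coord x n) => y yx yn i.
by rewrite ltnS leq_eqVlt => /predU1P[->//|/yx].
Qed.

Lemma cvg_cantor (F : set_system C) (x : C) : Filter F ->
  (forall i, F [set y | y i = x i]) -> F --> x.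
Proof.
move=> FF Fx; apply/cvg_sup => i U [V [[B oB <-] Bx] BU].
by apply: (filterS BU); apply: filterS (Fx i) => y /= ->.
Qed.

Lemma cantor_continuous_at (T : topologicalType) (F : T -> C) (x : T) :
  (forall i, \forall y \near x, F y i = F x i) -> {for x, continuous F}.
Proof. by move=> Fx; exact: cvg_cantor. Qed.

Lemma nbhs_cylinder x U : nbhs x U -> exists n, cylinder x n `<=` U.
Proof.
move=> xU; pose F := filter_from [set: nat] (cylinder x).
have FF : Filter F.
  apply: filter_from_filter; first by exists 0.
  move=> i j _ _; exists (maxn i j) => // y xy; split=> k ki; apply: xy.
    by rewrite leq_max ki.
  by rewrite leq_max ki orbT.
have : F --> x.
  by apply: cvg_cantor => i; exists i.+1 => // y; exact.
by move=> /(_ _ xU) [n _]; exists n.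
Qed.

Lemma clopen_cylinder x n : clopen (cylinder x n).
Proof.
split.
  rewrite openE => y yx; apply: filterS (near_cylinder y n) => z zy i il.
  by rewrite zy// yx.
move=> y yx i il; have [z [zx zy]] := yx _ (near_cylinder y n).
by rewrite -zy// zx.
Qed.

Definition graft x n y : C := fun i => if (i < n)%N then x i else y (i - n)%N.
Definition shift n y : C := fun i => y (i + n)%N.

Lemma graft_continuous x n : continuous (graft x n).
Proof.
move=> y; apply: cantor_continuous_at => i; rewrite /graft.
case: ifP => _; first by apply: (@filterE _ (nbhs y)).
exact: near_coord.
Qed.

Lemma shift_continuous n : continuous (shift n).
Proof. by move=> y; apply: cantor_continuous_at => i; exact: near_coord. Qed.

Lemma graftK x n : cancel (graft x n) (shift n).
Proof.
by move=> y; apply/funext => i; rewrite /shift /graft ltnNge leq_addl addnK.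
Qed.

Lemma shiftK x n y : cylinder x n y -> graft x n (shift n y) = y.
Proof.
move=> yx; apply/funext => i; rewrite /graft /shift.
by case: ltnP => ni; [rewrite yx|rewrite subnK].
Qed.

Lemma graft_cylinder x n y : cylinder x n (graft x n y).
Proof. by move=> i il; rewrite /graft il. Qed.

(** Prepending the initial word of a point of [W] copies [U] into a cylinder inside [W].
    Disjointness allows [U] and its copy to be exchanged, which makes the embedding a homeomorphism
    of the whole space. *)
Lemma cantor_embed U W : clopen U -> clopen W -> W !=set0 ->
  U `&` W = set0 -> exists k : homeo C C, k @` U `<=` W.
Proof.
move=> cU [oW _] [x Wx] UW.
have [n xW] := nbhs_cylinder (open_nbhs_nbhs (conj oW Wx)).
pose B := cylinder x n `&` shift n @^-1` U.
have cB : clopen B.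
  apply: clopenI; first exact: clopen_cylinder.
  by apply: preimage_clopen => //; exact: shift_continuous.
have UB : U `&` B = set0.
  apply/seteqP; split=> // y [Uy [/xW Wy _]].
  by rewrite -UW; split.
have [||||||s [sU _ _]] := @swap_maps C U B (graft x n) (shift n) cU cB UB.
- move=> y Uy; split; first exact: graft_cylinder.
  by rewrite /preimage /mkset graftK.
- by move=> y [].
- by move=> y _; exact: graftK.
- by move=> y [yx _]; exact: shiftK.
- by move=> y _; exact: graft_continuous.
- by move=> y _; exact: shift_continuous.
exists s => _ [y Uy <-]; rewrite sU//; apply: xW; exact: graft_cylinder.
Qed.

(** Addition of one to a 2-adic integer with the least significant digit first: the carry reaches
    digit [n] when all earlier digits are 1. [odometer_inv] subtracts one with borrow. *)
Definition odometer_fun x : C := fun n => x n (+) all x (iota 0 n).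
Definition odometer_inv x : C :=
  fun n => x n (+) all (fun i => ~~ x i) (iota 0 n).

Lemma all_iotaS (p : pred nat) n :
  all p (iota 0 n.+1) = all p (iota 0 n) && p n.
Proof. by rewrite -addn1 iotaD all_cat /= andbT. Qed.

Lemma odometer_funK : cancel odometer_fun odometer_inv.
Proof.
move=> x; apply/funext => n; rewrite /odometer_inv.
have -> : all (fun i => ~~ odometer_fun x i) (iota 0 n) = all x (iota 0 n).
  elim: n => // n IH; rewrite !all_iotaS IH /odometer_fun.
  by case: (all _ _) => //=; rewrite addbT negbK.
by rewrite /odometer_fun -addbA addbb addbF.
Qed.

Lemma odometer_invK : cancel odometer_inv odometer_fun.
Proof.
move=> x; apply/funext => n; rewrite /odometer_fun.
have -> : all (odometer_inv x) (iota 0 n) = all (fun i => ~~ x i) (iota 0 n).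
  elim: n => // n IH; rewrite !all_iotaS IH /odometer_inv.
  by case: (all _ _) => //=; rewrite addbT.
by rewrite /odometer_inv -addbA addbb addbF.
Qed.

Lemma finitely_determined_continuous (F : C -> C) :
  (forall x y n, cylinder x n.+1 y -> F y n = F x n) -> continuous F.
Proof.
move=> Fn x; apply: cantor_continuous_at => n.
by apply: filterS (near_cylinder x n.+1) => y; exact: Fn.
Qed.

Lemma odometer_fun_continuous : continuous odometer_fun.
Proof.
apply: finitely_determined_continuous => x y n yx; rewrite /odometer_fun yx//.
congr addb; apply: eq_in_all => i; rewrite mem_iota => il.
by rewrite yx//; lia.
Qed.

Lemma odometer_inv_continuous : continuous odometer_inv.
Proof.
apply: finitely_determined_continuous => x y n yx; rewrite /odometer_inv yx//.
congr addb; apply: eq_in_all => i; rewrite mem_iota => il.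
by rewrite yx//; lia.
Qed.

Definition odometer : homeo C C := Homeo odometer_funK odometer_invK
  odometer_fun_continuous odometer_inv_continuous.

(** Adding [2 ^ n] keeps the first [n] digits and adds one to the sequence that follows. For the
    induction, [2 ^ n] is added twice: digit [n] flips back and exactly one of the additions carries
    further. *)
Lemma odometer_pow2 n x m : (odometer ^+ (2 ^ n))%g x m =
  if (m < n)%N then x m else x m (+) all x (iota n (m - n)).
Proof.
elim: n x m => [|n IH] x m; first by rewrite expn0 expg1 subn0.
have lt_eq y i : (i < n)%N -> (odometer ^+ (2 ^ n))%g y i = y i.
  by move=> il; rewrite IH il.
have eqn y : (odometer ^+ (2 ^ n))%g y n = ~~ y n.
  by rewrite IH ltnn subnn addbT.
have gt y i : (n < i)%N -> (odometer ^+ (2 ^ n))%g y i =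
    y i (+) (y n && all y (iota n.+1 (i - n.+1))).
  move=> ni; rewrite IH ltnNge (ltnW ni) /=.
  by have -> : (i - n)%N = (i - n.+1).+1 by lia.
rewrite expnS mul2n -addnn expgDE.
have [mn|mn|->] := ltngtP m n.
- by rewrite ltnS (ltnW mn) !lt_eq.
- rewrite ltnS leqNgt mn/= gt// eqn (gt x)//.
  have [xn|xn] /= := boolP (x n); first by rewrite addbF.
  rewrite addbF; congr addb; apply: eq_in_all => i; rewrite mem_iota => il.
  by rewrite gt ?(negbTE xn) ?addbF//; lia.
- by rewrite ltnSn !eqn negbK.
Qed.

(** Digits are corrected one at a time: adding [2 ^ n] flips digit [n] without disturbing the
    earlier ones. *)
Lemma odometer_transitive x z n : exists t, cylinder z n ((odometer ^+ t)%g x).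
Proof.
elim: n => [|n [t tz]]; first by exists 0.
have [e|ne] := eqVneq ((odometer ^+ t)%g x n) (z n).
  exists t => i; rewrite ltnS leq_eqVlt => /predU1P[->//|]; exact: tz.
exists (2 ^ n + t)%N => i il; rewrite expgDE odometer_pow2.
case: ltnP => ni; first exact: tz.
have -> : i = n by lia.
by rewrite subnn addbT; apply/eqP; rewrite -eqbF_neg; case: (z n) ne; case: (_ x n).
Qed.

(** The odometer is transported to the cylinder by [graft]; minimality follows from density of its
    forward orbits. *)
Lemma minimal_on_cylinder x n : exists f, minimal_on f (cylinder x n).
Proof.
pose u y := graft x n (odometer (shift n y)).
pose v y := graft x n ((odometer^-1)%g (shift n y)).
have cont (w : homeo C C) : continuous (fun y => graft x n (w (shift n y))).
  move=> y; apply: (@continuous_comp _ _ _ (fun y => w (shift n y))).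
    apply: continuous_comp; first exact: shift_continuous.
    exact: homeo_fun_continuous.
  exact: graft_continuous.
have [||||||f [fu _ fN]] := @glue_homeo C (cylinder x n) u v (clopen_cylinder x n).
- by move=> y _; exact: graft_cylinder.
- by move=> y _; exact: graft_cylinder.
- by move=> y yx; rewrite /u /v graftK homeoVK shiftK.
- by move=> y yx; rewrite /u /v graftK homeoKV shiftK.
- by move=> y _; exact: cont.
- by move=> y _; exact: cont.
exists f; split=> //.
- exact: clopen_cylinder.
- by exists x.
- move=> K clK Kx [y Ky] fK; apply/seteqP; split=> // z zx.
  apply: clK => U /nbhs_cylinder [m zU].
  have [t tz] := odometer_transitive (shift n y) (shift n z) m.
  have fKt s : K (graft x n ((odometer ^+ s)%g (shift n y))).
    elim: s => [|s IH]; first by rewrite /= shiftK//; exact: Kx.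
    pose w := graft x n ((odometer ^+ s)%g (shift n y)).
    have : K (f w) by apply: fK; exists w.
    rewrite /w fu; last exact: graft_cylinder.
    by rewrite /u graftK expgSE.
  exists (graft x n ((odometer ^+ t)%g (shift n y))); split=> //.
  apply: zU => i im; rewrite /graft; case: ltnP => ni; first by rewrite zx.
  by rewrite tz /shift ?subnK//; lia.
Qed.

End Cantor.

(** * Recurrence in compact minimal systems *)

Section Compact.
Variable X : ptopologicalType.
Hypothesis compactX : compact [set: X].

Lemma finite_subcover (U : X -> set X) : (forall x, nbhs x (U x)) ->
  exists s : seq X, forall y, exists2 x, x \in s & U x y.
Proof.
move=> nU; move: compactX; rewrite compact_cover => /(_ X setT (fun x => (U x)°)).
case=> [x _|x _|s _ sU]; first exact: open_interior.
  by exists x => //; exact: nU.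
exists (enum_fset s) => y; have [x xs Uxy] := sU y I.
by exists x => //; exact: interior_subset Uxy.
Qed.

(** The source of the uniform bounds on hitting times, periods and exponents. *)
Lemma compact_bounded (Q : nat -> X -> Prop) :
  (forall x : X, exists n, \forall y \near x, Q n y) ->
  exists N, forall y, exists2 n, (n <= N)%N & Q n y.
Proof.
move=> /choice[n Qn].
have [s sQ] := @finite_subcover (fun x => Q (n x)) Qn.
exists (\max_(x <- s) n x) => y; have [x xs Qxy] := sQ y.
by exists (n x) => //; rewrite (bigmax_sup_seq x).
Qed.

Lemma locally_constant_range (T : eqType) (c : X -> T) : locally_constant c ->
  exists s : seq T, [/\ uniq s, forall x, c x \in s &
    forall t, t \in s -> exists x, c x = t].
Proof.
move=> /finite_subcover[s cs]; exists (undup (map c s)).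
split; first exact: undup_uniq.
  move=> y; have [x xs ->] := cs y.
  by rewrite mem_undup map_f.
by move=> t; rewrite mem_undup => /mapP[x _ ->]; exists x.
Qed.

End Compact.

Section Minimal.
Variable X : topologicalType.
Implicit Types (f g h k : homeo X X) (x : X) (A B D K U W Y : set X).

Lemma minimal_minimal_on g : minimal g <-> minimal_on g setT.
Proof.
split=> [[X0 gK]|[_ X0 _ gK]]; split=> //.
- exact: clopenT.
- by move=> x [].
- move=> K clK _ [x Kx] gKK; apply: contrapT => KT.
  suff K0 : K = set0 by rewrite K0 in Kx.
  by apply: gK => //; rewrite properEneq; split=> //; exact/eqP.
- move=> K clK [KT nKT] gKK; apply: contrapT => /eqP/set0P K0.
  by apply: nKT; rewrite (gK K).
Qed.

Definition free_homeo g := forall x (n : int), expgz g n x = x -> n = 0%Z.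

(** A periodic orbit is finite, hence closed in a Hausdorff space, and invariant; by minimality it
    would be the whole infinite space. *)
Lemma minimal_free g : infinite_set [set: X] -> hausdorff_space X ->
  minimal g -> free_homeo g.
Proof.
move=> infX hX /minimal_minimal_on [_ _ _ gK] x n gx.
have [n0|n0] := eqVneq n 0%Z; first by [].
have [p p0 gpx] : exists2 p, (0 < p)%N & (g ^+ p)%g x = x.
  case: n n0 gx => n n0 gx; first by exists n => //; rewrite lt0n.
  by exists n.+1 => //; rewrite -[in LHS]gx homeoKV.
exfalso; apply: infX; rewrite -(gK [set (g ^+ i)%g x | i in `I_p])//.
- exact/finite_image/finite_II.
- move/accessible_finite_set_closed : (hausdorff_accessible hX); apply.
  exact/finite_image/finite_II.
- by exists x; exists 0.
- move=> _ [_ [i ip <-] <-]; rewrite -expgSE.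
  have [ip'|ip'] := ltnP i.+1 p; first by exists i.+1.
  by exists 0 => //=; rewrite (_ : i.+1 = p) ?gpx//; move: ip => /=; lia.
Qed.

Lemma free_inj g x (a b : int) :
  free_homeo g -> expgz g a x = expgz g b x -> a = b.
Proof.
move=> fg e; suff : (a - b)%R = 0%Z by lia.
apply: (fg (expgz g b x)); rewrite -expgzDE -e; congr (expgz g _ x); lia.
Qed.

(** Exponents are chosen pointwise; freeness makes them unique, which forces the choice to be
    locally constant. *)
Lemma germ_full_group g h : free_homeo g -> (forall x, germ g h x) ->
  topological_full_group g h.
Proof.
move=> fg /choice[c hc]; exists c => x; last exact: nbhs_singleton (hc x).
apply: filterS (hc x) => y hy; apply: (free_inj fg (x := y)).
exact: etrans (esym (nbhs_singleton (hc y))) hy.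
Qed.

Lemma full_group_germ g h x : topological_full_group g h -> germ g h x.
Proof. by move=> [c lc hc]; exists (c x); apply: filterS (lc x) => y <-. Qed.

End Minimal.

Section Recurrence.
Variable X : ptopologicalType.
Hypothesis compactX : compact [set: X].
Implicit Types (f g h k : homeo X X) (x : X) (A B D K U W Y : set X).

Lemma minimal_on_expg f W n x : minimal_on f W -> W ((f ^+ n)%g x) <-> W x.
Proof.
move=> mf; elim: n => // n <-; rewrite expgSE.
by split; [exact: minimal_on_inv|exact: minimal_on_fun].
Qed.

(** The points of [W] whose forward orbit avoids [Y] form a closed forward invariant set, empty by
    minimality. Compactness then bounds the hitting time. *)
Lemma minimal_on_hits f W Y : minimal_on f W -> open Y -> Y `&` W !=set0 ->
  exists N, forall x, W x -> exists2 n, (n <= N)%N & Y ((f ^+ n)%g x).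
Proof.
move=> mf; have [cW W0 fN fK] := mf; move=> oY [y [Yy Wy]].
have hit x : W x -> exists n, Y ((f ^+ n)%g x).
  move=> Wx; apply: contrapT => nohit.
  pose K := W `&` [set z | forall n, ~ Y ((f ^+ n)%g z)].
  have KW : K = W.
    apply: fK; last first.
    - move=> _ [z [Wz nz] <-]; split; first exact: minimal_on_fun mf Wz.
      by move=> n; rewrite -expgSrE; exact: nz.
    - by exists x; split=> // n Yn; apply: nohit; exists n.
    - by move=> z [].
    - apply: closedI; first by case: cW.
      rewrite (_ : mkset _ = \bigcap_n ((f ^+ n)%g @^-1` (~` Y))).
        by apply: closed_bigI => n _; apply: closed_preimage; exact: open_closedC.
      by apply/seteqP; split=> z nz n; [move=> _; exact: nz|exact: nz n I].
  by move: Wy; rewrite -KW => -[_ /(_ 0)].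
have [|N hN] := @compact_bounded X compactX
    (fun n z => W z -> Y ((f ^+ n)%g z)); last first.
  by exists N => x Wx; have [n nN /(_ Wx) Yn] := hN x; exists n.
move=> x; have [Wx|nWx] := pselect (W x).
  have [n Yn] := hit x Wx; exists n.
  have : nbhs x ((f ^+ n)%g @^-1` Y).
    by apply: open_nbhs_nbhs; split=> //; exact: open_preimage.
  by apply: filterS => z.
exists 0; have : nbhs x (~` W).
  by apply: open_nbhs_nbhs; split=> //; apply: closed_openC; case: cW.
by apply: filterS => z nWz /nWz.
Qed.

Lemma minimal_on_eq_tower f W Y : minimal_on f W -> open Y -> Y `<=` W ->
  Y !=set0 -> exists N, W = tower f Y N.
Proof.
move=> mf oY YW [y Yy].
have [|N hN] := minimal_on_hits mf oY; first by exists y; split=> //; exact: YW.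
exists N; apply/seteqP; split=> [x Wx|x [n _ [z Yz ->]]].
  (* Going back [N] steps first ensures that a visit at time [n <= N] occurs no later than [x], so
     [x] lies on level [N - n]. *)
  have [|n nN Yn] := hN ((f ^- N)%g x).
    by rewrite -(minimal_on_expg N _ mf) homeoKV.
  exists (N - n)%N; first exact: leq_subr.
  exists ((f ^+ n)%g ((f ^- N)%g x)) => //.
  by rewrite -expgDE subnK// homeoKV.
by rewrite (minimal_on_expg _ _ mf); exact: YW.
Qed.

Lemma hit_first_return g Y y t : (0 < t)%N -> Y ((g ^+ t)%g y) ->
  exists t', first_return g Y t' y.
Proof.
elim/ltn_ind: t => t IH t0 Yt.
have [[i [i0 it Yi]]|no] :=
  pselect (exists i, [/\ (0 < i)%N, (i < t)%N & Y ((g ^+ i)%g y)]).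
  exact: (IH i).
by exists t; split=> // i i0 it Yi; apply: no; exists i.
Qed.

Lemma minimal_on_first_return f W Y y : minimal_on f W -> open Y -> Y `<=` W ->
  Y y -> exists t, first_return f Y t y.
Proof.
move=> mf oY YW Yy.
have [|N hN] := minimal_on_hits mf oY; first by exists y; split=> //; exact: YW.
have [|n _ Yn] := hN (f y); first exact/(minimal_on_fun mf)/YW.
by apply: (@hit_first_return _ _ _ n.+1); rewrite ?expgSrE.
Qed.

(** By minimality [X2] is a tower over [Y2], so it can be attached through [k] and climbed by
    [g2^-1]. The return map that remains for [germ_tower] is conjugate by [k] to a return map of
    [g1], already a local power. *)
Lemma minimal_on_kakutani f W g1 X1 Y1 g2 X2 Y2 k :
  minimal_on f W -> minimal_on g1 X1 -> X1 `<=` W ->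
  (forall x, X1 x -> germ f g1 x) ->
  minimal_on g2 X2 -> W `&` X2 = set0 ->
  clopen Y1 -> Y1 `<=` X1 -> clopen Y2 -> Y2 `<=` X2 -> Y2 !=set0 ->
  k @` Y2 = Y1 ->
  (forall y t2 t1, Y2 y -> first_return g2 Y2 t2 y ->
    first_return g1 Y1 t1 (k y) -> k ((g2 ^+ t2)%g y) = (g1 ^+ t1)%g (k y)) ->
  exists f', [/\ minimal_on f' (W `|` X2), forall x, germ f' f x &
    forall x, X2 x -> germ f' g2 x].
Proof.
move=> mf m1 XW fg1 m2 WX cY1 YX1 cY2 YX2 Y20 kY kret.
have [N XT] := minimal_on_eq_tower m2 cY2.1 YX2 Y20.
have [||f' [mf' f'f f'k f'g]] :=
  minimal_on_attach (k := k) (g := g2) (N := N) mf cY2; rewrite -?XT//.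
  by rewrite kY => y /YX1/XW.
rewrite -XT in mf' f'g.
exists f'; split=> //; rewrite XT; apply: germ_tower; rewrite -?XT//.
  by move=> x; exact: minimal_on_fun m2.
move=> y t Yy rt; have [_ Yty _] := rt.
have kY1 z : Y2 z -> Y1 (k z) by move=> Yz; rewrite -kY; exists z.
have [t1 rt1] := minimal_on_first_return m1 cY1.1 YX1 (kY1 _ Yy).
(* Both return times are constant near [y], so this conjugate of [g1 ^+ t1] agrees with [g2 ^+ t] on
   a neighbourhood. *)
apply: (@germ_near _ _ (k^-1 * (g1 ^+ t1 * k))%g).
  apply: filterS3 (clopen_near y cY2) (near_first_return cY2 rt)
    (near_homeo (near_first_return cY1 rt1)) => z /iffRL /(_ Yy) Yz rz rkz.
  by rewrite !homeo_mulE -(kret z t t1)// homeoVK.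
apply: germM; last apply: germM.
- rewrite homeo_mulE -(@kret y t t1)//.
  by apply: germV; exact: f'k.
- apply: germX => i _; apply: germ_transT => //; apply: fg1.
  by rewrite (minimal_on_expg _ _ m1); exact/YX1/kY1.
- exact: f'k.
Qed.

End Recurrence.

(** * Cylinders around periodic points *)

Section Assemble.
Local Notation C := cantor_space.
Implicit Types (f g h k : homeo C C) (x y z : C) (U W : set C).

Lemma periodic_neighborhood h x p : (h ^+ p)%g x = x -> (0 < p)%N ->
  (forall n, (h ^+ n)%g x = x -> \forall y \near x, (h ^+ n)%g y = y) ->
  exists n q, [/\ (0 < q)%N,
    forall y, cylinder x n y -> (h ^+ q)%g y = y &
    forall y i, cylinder x n y -> (0 < i)%N -> (i < q)%N ->
      ~ cylinder x n ((h ^+ i)%g y)].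
Proof.
(* The number [q] is the least period of [x], obtained as the first return time to the singleton. *)
move=> hpx p0 hx; have [q [q0 hqx nov]] := @hit_first_return _ h [set x] x p p0 hpx.
have [N avoid] : exists N, \forall y \near x, forall i, (i < q)%N -> (0 < i)%N ->
    ~ cylinder x N ((h ^+ i)%g y).
  elim: q {q0 hqx} nov => [|q IH] nov.
    by exists 0; apply: (@filterE _ (nbhs x)).
  have [|N hN] := IH; first by move=> i i0 iq; exact/nov/leqW.
  case: (posnP q) => [q0|q0].
    by exists N; apply: (@filterE _ (nbhs x)) => y i; rewrite q0; case: i.
  have [j hj] : exists j, (h ^+ q)%g x j != x j.
    apply: contrapT => no; apply: (nov q q0 (ltnSn q)).
    apply/funext => j; apply/eqP/negPn/negP => ne; apply: no; by exists j.
  (* A cylinder longer than [j] sees the coordinate at which this iterate of [x] differs from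
     [x]. *)
  exists (maxn N j.+1); apply: filterS2 hN
    (near_homeo (near_coord ((h ^+ q)%g x) j)) => y hy hyj i.
  rewrite ltnS leq_eqVlt => /predU1P[->|iq] i0 yx.
    by move/eqP: hj; apply; rewrite -hyj yx// leq_max leqnn orbT.
  by apply: (hy i iq i0) => l lN; apply: yx; rewrite leq_max lN.
have [n xn] := nbhs_cylinder (filterI avoid (hx q hqx)).
have sub y : cylinder x (maxn N n) y -> cylinder x N y /\ cylinder x n y.
  by move=> yx; split=> i il; apply: yx; rewrite leq_max il ?orbT.
exists (maxn N n), q; split=> // [y /sub[_ /xn[]] //|y i].
by move=> /sub[_ /xn[av _]] i0 iq /sub[+ _]; exact: av.
Qed.

End Assemble.

(** * Assembling a minimal homeomorphism *)

(* Kakutani equivalence inside an ambient space: [k] conjugates the map induced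
   by [g2] on [Y2] to the map induced by [g1] on [Y1]. *)
Definition kakutani_pair (X : topologicalType) (g1 : homeo X X) (X1 : set X)
    (g2 : homeo X X) (X2 : set X) :=
  exists Y1 Y2 (k : homeo X X),
    [/\ clopen Y1 /\ Y1 `<=` X1, clopen Y2 /\ Y2 `<=` X2, Y2 !=set0,
      k @` Y2 = Y1 &
      forall y t2 t1, Y2 y -> first_return g2 Y2 t2 y ->
        first_return g1 Y1 t1 (k y) ->
        k ((g2 ^+ t2)%g y) = (g1 ^+ t1)%g (k y)].

(* On a compact clopen invariant set this amounts to strong periodicity. *)
Definition locally_periodic (X : topologicalType) (h : homeo X X) (A : set X) :=
  forall x, A x ->
    (exists2 p, (0 < p)%N & (h ^+ p)%g x = x) /\
    forall n, (h ^+ n)%g x = x -> \forall y \near x, (h ^+ n)%g y = y.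

Section Assemble.
Local Notation C := cantor_space.
Implicit Types (f g h k : homeo C C) (x y z : C) (U W : set C).

Lemma cantor_infinite : infinite_set [set: C].
Proof.
pose e n : C := fun i => i == n.
have e_inj : injective e.
  move=> m n /(congr1 (fun x : C => x m)) /=.
  by rewrite /e eqxx => /esym/eqP.
move=> fin; apply: infinite_nat.
rewrite -(preimage_setT e); apply: finite_preimage fin.
by move=> m n _ _; exact: e_inj.
Qed.

Lemma cantor_ppm h f : minimal_on f setT -> (forall x, germ f h x) -> ppm h.
Proof.
move=> /minimal_minimal_on mf fh; right; exists f => //.
apply: germ_full_group => //; apply: minimal_free => //.
  exact: cantor_infinite.
exact: cantor_space_hausdorff.
Qed.

(** Finitely many neighbourhoods cover the space, each inside [W] or a clopen set of constant period
    with disjoint translates. They are absorbed one after another; the part of the next one still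
    missing embeds into the set reached so far, which is nonempty. *)
Lemma ppm_absorb_periodic h f W : minimal_on f W ->
  (forall x, W (h x) <-> W x) -> (forall x, W x -> germ f h x) ->
  locally_periodic h (~` W) -> ppm h.
Proof.
move=> mf hW fh hper.
pose nice U := clopen U /\ exists q, [/\ (0 < q)%N,
  forall y, U y -> (h ^+ q)%g y = y &
  forall y i, U y -> (0 < i)%N -> (i < q)%N -> ~ U ((h ^+ i)%g y)].
have cover x : exists U, nbhs x U /\ (U `<=` W \/ nice U).
  have [Wx|nWx] := pselect (W x).
    exists W; split; last by left.
    by apply: open_nbhs_nbhs; split=> //; case: mf => -[].
  have [[p p0 hpx] hx] := hper x nWx.
  have [n [q [q0 hq qn]]] := periodic_neighborhood hpx p0 hx.
  exists (cylinder x n); split; first exact: near_cylinder.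
  by right; split; [exact: clopen_cylinder|exists q].
have /choice[U HU] := cover.
have [s sU] := finite_subcover cantor_space_compact (fun x => (HU x).1).
suff [f' [W' [mf' _ sW' _ fh']]] : exists f' W', [/\ minimal_on f' W',
    W `<=` W', forall x, x \in s -> U x `<=` W',
    forall x, W' (h x) <-> W' x & forall x, W' x -> germ f' h x].
  have W'T : W' = setT.
    by apply/seteqP; split=> // y _; have [x /sW' UW /UW] := sU y.
  rewrite W'T in mf' fh'; apply: (cantor_ppm mf') => x.
  exact: fh'.
elim: s {sU} => [|x s [f1 [W1 [mf1 WW1 sW1 hW1 fh1]]]]; first by exists f, W; split.
have [_ [UxW|[cU [q [q0 hq qn]]]]] := HU x.
  exists f1, W1; split=> // z; rewrite inE => /predU1P[->|/sW1//].
  exact: subset_trans WW1.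
have [k kW] : exists k : homeo C C, k @` (U x `&` ~` W1) `<=` W1.
  have [cW1 W10 _ _] := mf1.
  apply: cantor_embed => //.
    by apply: clopenI => //; exact: clopenC set0 cW1.
  by apply/seteqP; split=> // y [[]].
have [f2 [W2 [mf2 W12 UW2 hW2 fh2]]] :=
  minimal_on_periodic mf1 hW1 fh1 cU q0 hq qn kW.
exists f2, W2; split=> //; first exact: subset_trans W12.
by move=> z; rewrite inE => /predU1P[->//|/sW1]; move/subset_trans; apply.
Qed.

(** Without a minimal component to start from, an odometer is put on a cylinder around [point] and
    extended over the [h]-orbits of that cylinder. *)
Lemma ppm_periodic h : locally_periodic h setT -> ppm h.
Proof.
move=> hper; have [[p p0 hpx] hx] := hper point I.
have [n [q [q0 hq qn]]] := periodic_neighborhood hpx p0 hx.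
have [f mf] := minimal_on_cylinder point n.
set Y := cylinder point n in mf hq qn.
have cY : clopen Y by exact: clopen_cylinder.
have sYT : Y `<=` tower h Y q by exact: sub_tower.
have [//|//|f' [mf' _ f'h]] := minimal_on_tower (g := h) (N := q) mf cY.
have YT : Y `|` tower h Y q = tower h Y q by apply/setUidPr.
rewrite YT in mf'.
apply: (ppm_absorb_periodic mf').
- by move=> x; exact: periodic_tower_invariant.
- exact: germ_periodic_tower.
- by move=> x _; exact: hper.
Qed.

Lemma ppm_assemble h m (X : 'I_m -> set C) (g : 'I_m -> homeo C C) :
  locally_periodic h (~` \bigcup_i X i) ->
  (forall i j, i != j -> X i `&` X j = set0) ->
  (forall i x, X i (h x) <-> X i x) ->
  (forall i, minimal_on (g i) (X i)) ->
  (forall i x, X i x -> germ (g i) h x) ->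
  (forall i j, i != j -> kakutani_pair (g i) (X i) (g j) (X j)) ->
  ppm h.
Proof.
case: m X g => [|m] X g hper Xdisj hX mg gh kak.
  by apply: ppm_periodic => x _; apply: hper => -[[]].
pose W n := \bigcup_(i in [set i : 'I_m.+1 | (i <= n)%N]) X i.
have WS n : (n < m)%N -> W n.+1 = W n `|` X (inord n.+1).
  move=> nm; have jE : (inord n.+1 : 'I_m.+1) = n.+1 :> nat by rewrite inordK.
  apply/seteqP; split=> x.
    case=> i /=; rewrite leq_eqVlt => /predU1P[ij|il] Xi; last by left; exists i.
    by right; rewrite (_ : inord _ = i)//; apply: val_inj; rewrite /= jE ij.
  case=> [[i /= il] Xi|Xj]; first by exists i => //=; exact: leqW.
  by exists (inord n.+1) => //=; rewrite jE.
(* Each new component is glued to [X ord0], so the induction must also retain [g ord0] as a local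
   power of the map constructed so far. *)
have main n : (n <= m)%N -> exists f, [/\ minimal_on f (W n),
    forall x, W n x -> germ f h x & forall x, X ord0 x -> germ f (g ord0) x].
  elim: n => [_|n IH nm].
    have -> : W 0 = X ord0.
      apply/seteqP; split=> [x [i]|x]; last by exists ord0.
      by rewrite /= leqn0 => /eqP i0; rewrite (_ : i = ord0)//; exact: val_inj.
    exists (g ord0); split=> // [x|x _]; [exact: gh|exact: germ_refl].
  have [f [mf fh fg0]] := IH (ltnW nm); rewrite WS//; set j := inord n.+1.
  have jE : j = n.+1 :> nat by rewrite /j inordK.
  have [|Y1 [Y2 [k [[cY1 YX1] [cY2 YX2] Y20 kY ret]]]] := kak ord0 j.
    by apply/eqP => /(congr1 val) /=; rewrite jE.
  have [||f' [mf' f'f f'g]] := minimal_on_kakutani cantor_space_compact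
    mf (mg ord0) _ fg0 (mg j) _ cY1 YX1 cY2 YX2 Y20 kY ret.
  - by move=> x Xx; exists ord0.
  - apply/seteqP; split=> // x [[i /= il Xi] Xj].
    suff : (X i `&` X j) x by rewrite Xdisj//; apply/eqP => /(congr1 val)/=; lia.
    by [].
  exists f'; split=> //.
    move=> x [/fh fhx|Xx]; first exact: germ_transT fhx.
    apply: (@germ_trans _ (g j) _ _ (X j)) => //.
    - by move=> y; exact: minimal_on_fun.
    - by move=> y; exact: minimal_on_inv.
    - exact: gh.
  by move=> x /fg0; exact: germ_transT.
have [f [mf fh _]] := main m (leqnn m).
have WX : W m = \bigcup_i X i.
  apply/seteqP; split=> x [i _ Xi]; exists i => //=.
  by rewrite -ltnS.
rewrite WX in mf fh; apply: (ppm_absorb_periodic mf) => // x.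
by split=> -[i _ Xi]; exists i => //; exact/(hX i).
Qed.

End Assemble.

(** * Clopen subspaces *)

Section Subtype.
Variables (X : topologicalType) (A : set X).
Implicit Types (g k : homeo A A) (G K : homeo X X).

Lemma set_val_inj : injective (set_val : A -> X).
Proof. by rewrite set_valE; exact: val_inj. Qed.

Lemma set_val_surj x : A x -> exists a : A, set_val a = x.
Proof. by move=> /mem_set Ax; exists (SigSub Ax). Qed.

Lemma nbhs_subtype (a : A) (V : set A) :
  nbhs a V <-> exists2 U, nbhs (set_val a) U & set_val @^-1` U `<=` V.
Proof.
split=> [|[U aU UV]]; last first.
  by apply: filterS UV _; exact: (@initial_continuous _ _ (set_val : A -> X)).
rewrite nbhsE => -[W [[U oU <-] Ua] UV]; exists U => //.
by exists U.
Qed.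

Lemma near_subtype (P : X -> Prop) (a : A) : open A ->
  (\forall x \near set_val a, P x) <-> (\forall b \near a, P (set_val b)).
Proof.
move=> oA; split=> [aP|/nbhs_subtype[U aU UP]].
  by apply/nbhs_subtype; exists P.
have : nbhs (set_val a) A by apply: open_nbhs_nbhs; split=> //; exact: set_valP.
apply: filterS2 aU => x Ux /set_val_surj[b bx]; rewrite -bx.
by apply: UP; rewrite /preimage /= bx.
Qed.

Lemma continuous_at_subtype (Z : topologicalType) (F : X -> Z) (a : A) :
  open A -> {for a, continuous (F \o set_val)} ->
  {for set_val a, continuous F}.
Proof. by move=> oA cF P FP; apply/(near_subtype (P \o F))/cF. Qed.

Lemma open_subtype_image (V : set A) : open A -> open V -> open (set_val @` V).
Proof.
move=> oA; rewrite !openE => oV _ [a Va <-].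
apply/(near_subtype _ _ oA); apply: filterS (oV a Va) => b Vb.
by exists b.
Qed.

Lemma closed_subtype_image (V : set A) :
  closed A -> closed V -> closed (set_val @` V).
Proof.
move=> cA cV x Vx.
have [a ax] : exists a : A, set_val a = x.
  apply: set_val_surj; apply: cA => U xU; have [_ [[b _ <-] Ub]] := Vx U xU.
  by exists (set_val b); split=> //; exact: set_valP.
exists a => //; apply: cV => U /nbhs_subtype[U' aU' UU'].
rewrite ax in aU'; have [_ [[b Vb <-] Ub]] := Vx U' aU'.
by exists b; split=> //; exact: UU'.
Qed.

Lemma clopen_subtype_image (V : set A) :
  clopen A -> clopen V -> clopen (set_val @` V).
Proof.
by move=> [oA cA] [oV cV]; split;
  [exact: open_subtype_image|exact: closed_subtype_image].
Qed.

Lemma clopen_subtype_preimage (U : set X) : clopen U ->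
  clopen ((set_val : A -> X) @^-1` U).
Proof. by move=> cU; apply: preimage_clopen => //; exact: initial_continuous. Qed.

Lemma subtype_image_preimage (U : set X) : U `<=` A ->
  set_val @` ((set_val : A -> X) @^-1` U) = U.
Proof.
move=> UA; apply/seteqP; split=> [_ [a Ua <-]//|x Ux].
by have [a ax] := set_val_surj (UA _ Ux); exists a; rewrite //= /preimage /= ax.
Qed.

Lemma subtype_compact : compact A -> compact [set: A].
Proof.
move=> cA F FF _.
have [|x [Ax Fx]] := cA (set_val @ F) _.
  by apply: (@filterE _ F) => a; exact: set_valP.
have [a ax] := set_val_surj Ax; exists a; split=> // U V FU.
move=> /nbhs_subtype[V' aV' VV']; rewrite ax in aV'.
have [|_ [[b Ub <-] Vb]] := Fx (set_val @` U) V' _ aV'.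
  change (F (set_val @^-1` (set_val @` U))).
  by apply: filterS FU => b Ub; exists b.
by exists b; split=> //; exact: VV'.
Qed.

Lemma subtype_hausdorff : hausdorff_space X -> hausdorff_space A.
Proof.
move=> hX a b ab; apply: set_val_inj; apply: hX => U V aU bV.
have [||c [Uc Vc]] := ab (set_val @^-1` U) (set_val @^-1` V).
- by apply/nbhs_subtype; exists U.
- by apply/nbhs_subtype; exists V.
- by exists (set_val c).
Qed.

(** As a relation, this covers both the restriction of a homeomorphism to an invariant set and the
    extension by the identity. *)
Definition extends G g := forall a : A, G (set_val a) = set_val (g a).

Lemma restr_extends G (GA : G @` A = A) : extends G (restr_homeo GA).
Proof. by []. Qed.

Lemma extends_expg G g n a : extends G g ->
  (G ^+ n)%g (set_val a) = set_val ((g ^+ n)%g a).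
Proof. by move=> Gg; elim: n => // n IH; rewrite !expgSE IH Gg. Qed.

Lemma extends_expgz G g n a : extends G g ->
  expgz G n (set_val a) = set_val (expgz g n a).
Proof.
move=> Gg; case: n => n; first exact: extends_expg.
apply: (@homeo_injective _ _ (G ^+ n.+1)%g).
rewrite (extends_expg _ _ Gg) homeoKV; congr set_val.
by rewrite homeoKV.
Qed.

Lemma extension_exists g : clopen A ->
  exists2 G, extends G g & forall x, ~ A x -> G x = x.
Proof.
move=> cA.
pose ext (w : homeo A A) x :=
  if pselect (A x) is left Ax then set_val (w (SigSub (mem_set Ax))) else x.
have extE w (a : A) : ext w (set_val a) = set_val (w a).
  rewrite /ext; case: pselect => [Aa|[]]; last exact: set_valP.
  by congr (set_val (w _)); exact: set_val_inj.
have extA w x : A x -> A (ext w x).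
  by move=> /set_val_surj[a <-]; rewrite extE; exact: set_valP.
have ext_cont w x : A x -> {for x, continuous (ext w)}.
  move=> /set_val_surj[a <-]; apply: continuous_at_subtype; first by case: cA.
  have -> : ext w \o set_val = set_val \o w by apply/funext => b; exact: extE.
  apply: continuous_comp; first exact: homeo_fun_continuous.
  exact: initial_continuous.
have extK (w w' : homeo A A) : cancel w w' -> forall x, A x -> ext w' (ext w x) = x.
  by move=> ww' x /set_val_surj[a <-]; rewrite !extE ww'.
have [G [GA _ GN]] := glue_homeo cA (extA g) (extA (g^-1)%g)
  (extK g (g^-1)%g (homeoVK g)) (extK (g^-1)%g g (homeoKV g))
  (ext_cont g) (ext_cont (g^-1)%g).
by exists G => // a; rewrite GA ?extE//; exact: set_valP.
Qed.

Lemma extends_germ G K g k a : open A -> extends G g -> extends K k ->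
  germ G K (set_val a) <-> germ g k a.
Proof.
move=> oA Gg Kk; split=> -[n h]; exists n.
  move/(near_subtype _ _ oA) : h; apply: filterS => b.
  by rewrite Kk (extends_expgz _ _ Gg) => /set_val_inj.
apply/(near_subtype _ _ oA); apply: filterS h => b kb.
by rewrite Kk (extends_expgz _ _ Gg) kb.
Qed.

Lemma extends_minimal_sub G g : closed A -> A !=set0 -> extends G g ->
  (forall K : set X, closed K -> K `<=` A -> K !=set0 -> G @` K `<=` K ->
    K = A) -> minimal g.
Proof.
move=> cA [_ /set_val_surj[a _]] Gg GK; apply/minimal_minimal_on; split.
- exact: clopenT.
- by exists a.
- by move=> b [].
- move=> K clK _ [b Kb] gK; apply/seteqP; split=> // c _.
  have : (set_val @` K) (set_val c).
    rewrite (GK (set_val @` K)); first exact: set_valP.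
    + exact: closed_subtype_image.
    + by move=> _ [d _ <-]; exact: set_valP.
    + by exists (set_val b); exists b.
    + move=> _ [_ [d Kd <-] <-]; rewrite Gg; exists (g d) => //.
      by apply: gK; exists d.
  by move=> [d Kd /set_val_inj <-].
Qed.

Lemma extends_minimal G g : clopen A -> extends G g ->
  (forall x, ~ A x -> G x = x) -> minimal g -> minimal_on G A.
Proof.
move=> cA Gg GN /minimal_minimal_on[_ [a _] _ gK].
split=> //; first by exists (set_val a); exact: set_valP.
move=> K clK KA [x Kx] GKK; have [b bx] := set_val_surj (KA _ Kx).
rewrite -(subtype_image_preimage KA) (gK ((set_val : A -> X) @^-1` K))//.
- apply/seteqP; split=> [_ [c _ <-]|y Ay]; first exact: set_valP.
  by have [c cy] := set_val_surj Ay; exists c.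
- by apply: preimage_closed => // c _; exact: initial_continuous.
- by exists b; rewrite /preimage /= bx.
- move=> _ [c Kc <-]; rewrite /preimage /= -Gg; apply: GKK.
  by exists (set_val c).
Qed.

Lemma extends_first_return G g (Y : set A) t a : extends G g ->
  first_return G (set_val @` Y) t (set_val a) <-> first_return g Y t a.
Proof.
move=> Gg.
have YE n : (set_val @` Y) ((G ^+ n)%g (set_val a)) <-> Y ((g ^+ n)%g a).
  rewrite (extends_expg _ _ Gg); split=> [[b Yb /set_val_inj <-]//|Yn].
  by exists ((g ^+ n)%g a).
split=> -[t0 /YE Yt nov]; split=> // i i0 it /YE; exact: nov.
Qed.

End Subtype.

(** Once a first return time is known, the default branch of [induced] is excluded. *)
Lemma first_return_induced (X : topologicalType) (g : homeo X X) (Y : set X) t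
    (y : Y) :
  first_return g Y t (set_val y) ->
  set_val (induced g y) = (g ^+ t)%g (set_val y).
Proof.
move=> [t0 Yt nov].
have ret : returns g y t by rewrite /returns t0; apply/mem_set.
rewrite /induced; case: pselect => [ex|[]]; last by exists t.
change ((g ^+ ex_minn ex)%g (set_val y) = (g ^+ t)%g (set_val y)).
case: ex_minnP => s /andP[s0 /set_mem Ys] smin.
have [st|ts|->//] := ltngtP s t; first by case: (nov s s0 st).
by have := smin t ret; rewrite leqNgt ts.
Qed.

(** A Kakutani equivalence lives on subspaces of subspaces, whereas [swap_maps] takes total
    functions on [X]; values off [Y] are arbitrary. *)
Lemma nested_extension (X : topologicalType) (A : set X) (Y : set A)
    (F : Y -> X) : open A -> open Y -> continuous F ->
  exists u : X -> X, forall y : Y, u (set_val (set_val y)) = F y /\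
    {for set_val (set_val y), continuous u}.
Proof.
move=> oA oY cF.
pose u x := if pselect (exists y : Y, set_val (set_val y) = x) is left e
  then F (projT1 (cid e)) else x.
have uE (y : Y) : u (set_val (set_val y)) = F y.
  rewrite /u; case: pselect => [e|[]]; last by exists y.
  by case: cid => z /= /set_val_inj/set_val_inj ->.
exists u => y; split=> //.
do 2![apply: continuous_at_subtype => //].
have -> : (u \o set_val) \o set_val = F by apply/funext => z; exact: uE.
exact: cF.
Qed.

(** Disjointness of [A1] and [A2] lets the partial conjugacy extend to [X] as an exchange of its
    domain and range. The equivalence is read from [g2] to [g1], the direction in which a new
    component is attached to an old one. *)
Lemma kakutani_equivalent_pair (X : topologicalType) (A1 A2 : set X)
    (G1 G2 : homeo X X) (g1 : homeo A1 A1) (g2 : homeo A2 A2) :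
  clopen A1 -> clopen A2 -> A1 `&` A2 = set0 ->
  extends G1 g1 -> extends G2 g2 ->
  kakutani_equivalent g2 g1 -> kakutani_pair G1 A1 G2 A2.
Proof.
move=> cA1 cA2 A12 Gg1 Gg2 [Y2 [Y1 [cY2 [y2 Yy2] cY1 _ [k kind]]]].
pose e1 (y : Y1) := set_val (set_val y).
pose e2 (y : Y2) := set_val (set_val y).
have ce1 : continuous e1.
  by move=> y; apply: continuous_comp; exact: initial_continuous.
have ce2 : continuous e2.
  by move=> y; apply: continuous_comp; exact: initial_continuous.
have [|u uP] := @nested_extension X A2 Y2 (e1 \o k) cA2.1 cY2.1.
  move=> y; apply: continuous_comp; first exact: homeo_fun_continuous.
  exact: ce1.
have [|v vP] := @nested_extension X A1 Y1 (e2 \o homeo_inv k) cA1.1 cY1.1.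
  move=> y; apply: continuous_comp; first exact: homeo_inv_continuous.
  exact: ce2.
have sub1 x : (set_val @` Y1) x -> exists y, e1 y = x.
  by move=> [a /set_val_surj[y <-] <-]; exists y.
have sub2 x : (set_val @` Y2) x -> exists y, e2 y = x.
  by move=> [a /set_val_surj[y <-] <-]; exists y.
have in1 y : (set_val @` Y1) (e1 y) by exists (set_val y) => //; exact: set_valP.
have in2 y : (set_val @` Y2) (e2 y) by exists (set_val y) => //; exact: set_valP.
have [|||||||||s [s2 s1 _]] := @swap_maps X (set_val @` Y2) (set_val @` Y1) u v.
- exact: clopen_subtype_image.
- exact: clopen_subtype_image.
- apply/seteqP; split=> // x [[a _ ax] [b _ bx]].
  by rewrite -A12; split; [rewrite -bx|rewrite -ax]; exact: set_valP.
- by move=> x /sub2[y <-]; rewrite (uP y).1; exact: in1.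
- by move=> x /sub1[y <-]; rewrite (vP y).1; exact: in2.
- by move=> x /sub2[y <-]; rewrite (uP y).1 (vP (k y)).1 /= homeo_funK.
- by move=> x /sub1[y <-]; rewrite (vP y).1 (uP (homeo_inv k y)).1 /= homeo_invK.
- by move=> x /sub2[y <-]; exact: (uP y).2.
- by move=> x /sub1[y <-]; exact: (vP y).2.
have sE y : s (e2 y) = e1 (k y) by rewrite s2 ?(uP y).1.
exists (set_val @` Y1), (set_val @` Y2), s; split.
- split; first exact: clopen_subtype_image.
  by move=> _ [a _ <-]; exact: set_valP.
- split; first exact: clopen_subtype_image.
  by move=> _ [a _ <-]; exact: set_valP.
- by exists (set_val y2); exists y2.
- apply/seteqP; split=> [_ [_ /sub2[y <-] <-]|_ /sub1[y <-]].
    by rewrite sE; exact: in1.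
  by exists (e2 (homeo_inv k y)); rewrite ?sE ?homeo_invK//; exact: in2.
- move=> _ t2 t1 /sub2[y <-]; rewrite sE => r2 r1.
  have i2 := first_return_induced ((extends_first_return _ _ _ Gg2).1 r2).
  have i1 := first_return_induced ((extends_first_return _ _ _ Gg1).1 r1).
  rewrite /e1 /e2 (extends_expg _ _ Gg2) (extends_expg _ _ Gg1) -i2 -i1.
  rewrite [LHS]sE /e1; congr (set_val (set_val _)).
  exact: (congr1 (fun f => f y) kind).
Qed.

(** * Strong periodicity as local periodicity *)

Lemma locally_constant_clopen (X : topologicalType) (T : Type) (c : X -> T) t :
  locally_constant c -> clopen [set x | c x = t].
Proof.
move=> lc; split.
  rewrite openE => x cx; apply: filterS (lc x) => y e.
  exact: etrans e cx.
by move=> x /(_ _ (lc x))[y [/= <- ->]].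
Qed.

Lemma cyclic_group_commute (X : topologicalType) (r a b : homeo X X) :
  cyclic_group r a -> cyclic_group r b -> commute a b.
Proof.
move=> [m _ <-] [n _ <-]; rewrite /commute -!expgzD; congr expgz; lia.
Qed.

Lemma cyclic_groupX (X : topologicalType) (r : homeo X X) n :
  cyclic_group r (r ^+ n)%g.
Proof. by exists (Posz n). Qed.

(** Cyclic groups are commutative, so conjugation within the group fixes all its subsets, and
    stabilizers can be compared by equality. *)
Lemma conjugate_in_cyclic (X : topologicalType) (r : homeo X X)
    (H K : set (homeo X X)) : K `<=` cyclic_group r ->
  conjugate_in (cyclic_group r) H K <-> H = K.
Proof.
move=> KG.
have conjK g : cyclic_group r g -> [set (k ^ g)%g | k in K] = K.
  move=> Gg; have cK k : K k -> (k ^ g)%g = k.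
    by move=> /KG Gk; rewrite conjgE (cyclic_group_commute Gk Gg) mulKg.
  apply/seteqP; split=> [_ [k Kk <-]|k Kk]; first by rewrite cK.
  by exists k => //; exact: cK.
split=> [[g Gg ->]|->]; first exact: conjK.
have G1 : cyclic_group r 1%g by exact: (cyclic_groupX r 0).
by exists 1%g => //; rewrite conjK.
Qed.

Lemma not_injective_nat (T : Type) (f : nat -> T) : finite_set (range f) ->
  exists i j, (i < j)%N /\ f i = f j.
Proof.
move=> fin; apply: contrapT => no; apply: infinite_nat.
suff : finite_set (f @^-1` range f).
  by rewrite (_ : _ @^-1` _ = setT)//; apply/seteqP; split=> // i _; exists i.
apply: finite_preimage fin => i j _ _ fij.
have [ij|ji|//] := ltngtP i j; exfalso; apply: no; first by exists i, j.
by exists j, i.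
Qed.

(** Finite index makes two cosets of powers of [r] coincide, which puts a positive power into the
    stabilizer. Since the sets of constant stabilizer are open, what fixes a point fixes its
    neighbours. *)
Lemma strongly_periodic_local (X : topologicalType) (h : homeo X X) (A : set X)
    (hA : h @` A = A) : clopen A -> strongly_periodic (restr_homeo hA) ->
  locally_periodic h A.
Proof.
move=> [oA _] [n [K [_ Kfi cS [covS _ _]]]] x /set_val_surj[a <-].
set r := restr_homeo hA in K Kfi cS covS.
have [j _ Sja] : (\bigcup_(j in setT) [set x0 |
    conjugate_in (cyclic_group r) (stabilizer (cyclic_group r) x0) (K j)]) a.
  by rewrite -/(cover _ _) covS.
have [[KG _] Kfin] := Kfi j.
have stabE b :
    conjugate_in (cyclic_group r) (stabilizer (cyclic_group r) b) (K j) ->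
    stabilizer (cyclic_group r) b = K j by move/(conjugate_in_cyclic _ KG).
have hr := extends_expg _ _ (restr_extends hA).
split.
  have [|i [l [il e]]] := @not_injective_nat _
      (fun i => [set ((r ^+ i) * k)%g | k in K j]).
    apply: sub_finite_set Kfin => _ [i _ <-].
    by exists (r ^+ i)%g => //; exact: cyclic_groupX.
  have K1 : K j 1%g.
    rewrite -(stabE _ Sja); split=> //; exact: (cyclic_groupX r 0).
  have : [set (r ^+ i * k)%g | k in K j] (r ^+ l)%g.
    by rewrite e; exists 1%g; rewrite ?mulg1.
  case=> k; rewrite -(stabE _ Sja) => -[_ ka] kl.
  have kE : k = (r ^+ (l - i))%g.
    rewrite -[k](mulKg (r ^+ i)%g) kl -(subnKC (ltnW il)) expgnDr mulKg.
    by rewrite subnKC ?(ltnW il).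
  exists (l - i)%N; first by rewrite subn_gt0.
  by rewrite hr -kE ka.
move=> m; rewrite hr => /set_val_inj ra.
have Km : K j (r ^+ m)%g.
  by rewrite -(stabE _ Sja); split=> //; exact: cyclic_groupX.
apply/(near_subtype _ _ oA).
have : \forall b \near a,
    conjugate_in (cyclic_group r) (stabilizer (cyclic_group r) b) (K j).
  by apply: open_nbhs_nbhs; split=> //; case: (cS j).
apply: filterS => b /stabE bE; rewrite hr.
by move: Km; rewrite -bE => -[_ ->].
Qed.

Lemma expg_mul_fixed (X : topologicalType) (h : homeo X X) n p x :
  (h ^+ p)%g x = x -> (h ^+ (n * p))%g x = x.
Proof. by move=> hp; elim: n => // n IH; rewrite mulSn expgDE IH. Qed.

Lemma locally_periodic_exponent (X : ptopologicalType) (h : homeo X X)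
    (A : set X) : compact [set: X] -> clopen A -> locally_periodic h A ->
  exists2 M, (0 < M)%N & forall x, A x -> (h ^+ M)%g x = x.
Proof.
move=> cX cA hper.
have [|N hN] := compact_bounded cX
  (Q := fun p x => A x -> (0 < p)%N /\ (h ^+ p)%g x = x).
  move=> x; have [Ax|nAx] := pselect (A x).
    have [[p p0 hp] /(_ p hp) hx] := hper x Ax.
    by exists p; apply: filterS hx => y hy.
  by exists 0; apply: filterS (clopen_near x cA) => y yA /yA.
exists N`!; first exact: fact_gt0.
move=> x Ax; have [p pN /(_ Ax)[p0 hp]] := hN x.
have /dvdnP[q ->] : p %| N`! by apply: dvdn_fact; rewrite p0.
exact: expg_mul_fixed.
Qed.

Lemma hausdorff_near_neq (X : topologicalType) (h : homeo X X) x :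
  hausdorff_space X -> h x <> x -> \forall y \near x, h y <> y.
Proof.
move=> hX hx; apply: contrapT => no; apply: hx; apply: hX => U V hxU xV.
apply: contrapT => UV; apply: no.
apply: filterS2 (near_homeo hxU) xV => y Uhy Vy hy.
by apply: UV; exists y; split=> //; rewrite -hy.
Qed.

(** The restriction has finite order, so a stabilizer is determined by finitely many powers. Being
    fixed by a power is an open condition by local periodicity and a closed one by the Hausdorff
    property. Thus stabilizers are locally constant, and the subgroups sought are their finitely
    many values. *)
Lemma local_strongly_periodic (X : ptopologicalType) (h : homeo X X)
    (A : set X) (hA : h @` A = A) : compact [set: X] -> hausdorff_space X ->
  clopen A -> locally_periodic h A -> strongly_periodic (restr_homeo hA).
Proof.
move=> cX hX cA hper; have [M M0 hM] := locally_periodic_exponent cX cA hper.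
set r := restr_homeo hA; have hr := extends_expg _ _ (restr_extends hA).
have rM : (r ^+ M)%g = 1%g.
  apply: homeoP => a; apply: set_val_inj; rewrite -hr hM//; exact: set_valP.
have cycE g : cyclic_group r g -> exists2 i, (i < M)%N & g = (r ^+ i)%g.
  move=> [n _ <-]; exists `|(n %% M)%Z|%N.
    have := ltz_mod n (d := M); have := modz_ge0 n (d := M); lia.
  have -> : (r ^+ `|(n %% M)%Z|)%g = expgz r (n %% M)%Z.
    by rewrite -[in RHS](@gez0_abs (n %% M)%Z)//; apply: modz_ge0; lia.
  rewrite [in LHS](divz_eq n M) GRing.mulrC expgzD expgzM [expgz r M]/= rM.
  suff -> : expgz (1 : homeo A A)%g (n %/ M)%Z = 1%g by rewrite mul1g.
  by case: (n %/ M)%Z => q; rewrite /= expg1n ?invg1.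
have Gfin : finite_set (cyclic_group r).
  apply: (@sub_finite_set _ _ [set (r ^+ i)%g | i in `I_M]).
    by move=> g /cycE[i iM ->]; exists i.
  exact/finite_image/finite_II.
pose stab := stabilizer (cyclic_group r).
have stab_near a : \forall b \near a, stab b = stab a.
  have fixE i : \forall b \near a, (r ^+ i)%g b = b <-> (r ^+ i)%g a = a.
    have key : \forall x \near set_val a,
        (h ^+ i)%g x = x <-> (h ^+ i)%g (set_val a) = set_val a.
      have [e|ne] := pselect ((h ^+ i)%g (set_val a) = set_val a).
        by apply: filterS ((hper _ (set_valP a)).2 _ e) => x ->.
      by apply: filterS (hausdorff_near_neq hX ne) => x nx; split.
    move/(near_subtype _ _ cA.1) : key; apply: filterS => b; rewrite !hr.
    by split=> [rb|ra]; apply: set_val_inj; apply/H; rewrite ?rb ?ra.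
  have : \forall b \near a, forall i, (i < M)%N ->
      (r ^+ i)%g b = b <-> (r ^+ i)%g a = a.
    elim: (M) => [|m IH]; first by apply: (@filterE _ (nbhs a)).
    apply: filterS2 (fixE m) IH => b bm bi i.
    by rewrite ltnS leq_eqVlt => /predU1P[->|/bi].
  apply: filterS => b bi; apply/seteqP; split=> g [Gg gb]; split=> //;
    by have [i iM gE] := cycE g Gg; move: gb; rewrite gE => /(bi i iM).
(* The stabilizer map is extended to all of [X] by the value [None], which also handles empty [A];
   [pmap id] discards that value below. *)
pose c x : option (set (homeo A A)) :=
  if pselect (A x) is left Ax then Some (stab (SigSub (mem_set Ax))) else None.
have cE a : c (set_val a) = Some (stab a).
  rewrite /c; case: pselect => [Aa|[]]; last exact: set_valP.
  by congr (Some (stab _)); exact: set_val_inj.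
have lc : locally_constant c.
  move=> x; have [/set_val_surj[a <-]|nAx] := pselect (A x).
    apply/(near_subtype _ _ cA.1); apply: filterS (stab_near a) => b e.
    by rewrite !cE e.
  apply: filterS (clopen_near x cA) => y yA.
  have nAy : ~ A y by move/yA.
  by rewrite /c; case: pselect => //; case: pselect.
have [s [us cs sc]] := locally_constant_range cX lc.
pose L := pmap id s.
have LP K : K \in L <-> exists a, stab a = K.
  rewrite mem_pmap map_id; split=> [/sc[x]|[a <-]]; last by rewrite -cE.
  by rewrite /c; case: pselect => // Ax [e]; exists (SigSub (mem_set Ax)).
have uL : uniq L by apply: (@pmap_uniq _ _ id Some) us; case.
have injL : injective (tnth (in_tuple L)).
  move=> i j; rewrite !(tnth_nth set0) => /eqP.
  by rewrite nth_uniq//= => /eqP/val_inj.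
exists (size L), (tnth (in_tuple L)).
have stabG a : stab a `<=` cyclic_group r by move=> g [].
have KL j : exists a, stab a = tnth (in_tuple L) j.
  by apply/LP; rewrite mem_tnth.
have SE j : [set a | conjugate_in (cyclic_group r)
    (stabilizer (cyclic_group r) a) (tnth (in_tuple L) j)] =
    [set a | stab a = tnth (in_tuple L) j].
  have [b bj] := KL j.
  apply/seteqP; split=> a /= e; apply/(conjugate_in_cyclic (r := r)) => //.
  - by rewrite -bj; exact: stabG.
  - by rewrite -bj; exact: stabG.
split.
- exact: injL.
- move=> j; have [b <-] := KL j; split; last exact: finite_image.
  split; first exact: stabG.
  split; first by apply/mem_set; split=> //; exact: (cyclic_groupX r 0).
  move=> g1 g2 /set_mem[[m _ <-] e1] /set_mem[[n _ <-] e2]; apply/mem_set; split.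
    by rewrite -expgzN -expgzD; exists (m - n)%R.
  by rewrite homeo_mulE -[in X in _ = X]e1 -[in X in _ X = _]e2 homeoVK.
- move=> j; rewrite SE; exact: locally_constant_clopen stab_near.
- split.
  + apply/seteqP; split=> // a _.
    have : stab a \in L by apply/LP; exists a.
    move=> /(tnthP (in_tuple L))[j e]; exists j => //.
    suff : [set b | stab b = tnth (in_tuple L) j] a by rewrite -SE.
    by [].
  + by move=> i j _ _ [a []]; rewrite !SE /= => -> /injL.
  + by move=> j _; have [a aj] := KL j; exists a; rewrite SE.
Qed.

(** * From a decomposition to a single minimal homeomorphism *)

Lemma invariant_iff (X : topologicalType) (h : homeo X X) (A : set X) :
  h @` A = A -> forall x, A (h x) <-> A x.
Proof.
move=> hA x; split=> [|Ax]; rewrite -{1}hA; last by exists x.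
by move=> [y Ay /homeo_injective <-].
Qed.

Lemma decomposition_ppm (h : homeo cantor_space cantor_space) (m : nat)
    (X0 : set cantor_space) (X : 'I_m -> set cantor_space)
    (hX0 : h @` X0 = X0) (hX : forall i, h @` X i = X i) :
  X0 `|` \bigcup_i X i = [set: cantor_space] -> trivIset [set: 'I_m] X ->
  clopen X0 -> (forall i, clopen (X i)) ->
  strongly_periodic (restr_homeo hX0) ->
  kakutani_compatible (fun i => restr_homeo (hX i)) -> ppm h.
Proof.
move=> cov disj cX0 cX hper [g [mg kg gh]].
have /choice[G GP] : forall i, exists G : homeo cantor_space cantor_space,
    extends G (g i) /\ forall x, ~ X i x -> G x = x.
  by move=> i; have [G] := extension_exists (g i) (cX i); exists G.
have Xdisj i j : i != j -> X i `&` X j = set0.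
  move=> ij; apply/seteqP; split=> // x Xx; apply/(negP ij)/eqP.
  by apply: disj => //; exists x.
apply: (@ppm_assemble h m X G) => //.
- move=> x nX; apply: (strongly_periodic_local cX0 hper).
  by have : [set: cantor_space] x by []; rewrite -cov => -[].
- by move=> i; exact: invariant_iff.
- move=> i; apply: (extends_minimal (cX i) (GP i).1 (GP i).2).
  by case: (mg i).
- move=> i x /set_val_surj[a <-].
  apply/(extends_germ _ (cX i).1 (GP i).1 (restr_extends (hX i))).
  exact: full_group_germ.
- move=> i j ij.
  exact: (kakutani_equivalent_pair (cX i) (cX j) (Xdisj _ _ ij) (GP i).1 (GP j).1).
Qed.

(** * Closed invariant sets of infinite orbits *)

Section Sequences.
Local Open Scope ring_scope.

(** The first term that reaches [j] exceeds it by at most one step. *)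
Lemma bounded_step_hits (e : nat -> int) (M : int) : e 0%N = 0 -> 0 <= M ->
  (forall n, e n.+1 - e n <= M) -> (forall b, exists n, b <= e n) ->
  forall j, 0 <= j -> exists n, `|j - e n| <= M.
Proof.
move=> e0 M0 step unb j j0.
have ex : exists n, j <= e n by exact: unb.
case: (ex_minnP ex) => -[|n] jn nmin.
  by exists 0%N; rewrite e0 in jn *; lia.
exists n.+1; have := step n.
have : ~~ (j <= e n) by apply/negP => /nmin; rewrite ltnn.
lia.
Qed.

(** An injective integer sequence is unbounded on at least one side; if it is bounded above, the
    one-sided lemma is applied to its negative. *)
Lemma injective_bounded_step (e : nat -> int) (M : int) :
  injective e -> e 0%N = 0 -> (forall n, `|e n.+1 - e n| <= M) ->
  (forall j, 0 <= j -> exists n, `|j - e n| <= M) \/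
  (forall j, j <= 0 -> exists n, `|j - e n| <= M).
Proof.
move=> einj e0 step; have M0 : 0 <= M by have := step 0%N; lia.
have [unb|/existsNP[b /forallNP eb]] := pselect (forall b, exists n, b <= e n).
  left; apply: bounded_step_hits => // n; have := step n; lia.
right=> j j0.
have neg : forall i, 0 <= i -> exists n, `|i - (- e n)| <= M.
  apply: (@bounded_step_hits (fun n => - e n)) => //.
  - by rewrite e0.
  - by move=> n; have := step n; lia.
  - move=> a; apply: contrapT => /forallNP ea.
    (* Otherwise all terms lie strictly between [- a] and [b], and two of them coincide. *)
    have [|k [l [kl ekl]]] := @not_injective_nat _ (fun n => `|(e n + a)%R|%N).
      apply: (@sub_finite_set _ _ `I_(`|(a + b)%R|.+1)) => [_ [n _ <-] /=|].
        have := ea n; have := eb n; lia.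
      exact: finite_II.
    have kl' : e k = e l by have := ea k; have := ea l; lia.
    by move: kl; rewrite (einj _ _ kl') ltnn.
have [|n hn] := neg (- j); first by lia.
exists n; lia.
Qed.

End Sequences.

Section Minimal.
Variable X : ptopologicalType.
Hypothesis compactX : compact [set: X].
Implicit Types (g h : homeo X X) (x : X) (A K U W : set X).

(** Were [K] proper, every [g]-orbit in [W] would leave [K] within [N] steps. But an orbit started
    [N] steps before a point of [K] stays in [K] that long. *)
Lemma minimal_on_inverse g W : minimal_on g W -> minimal_on (g^-1)%g W.
Proof.
move=> mg; have [cW W0 gN _] := mg; split=> //.
  by move=> x /gN gx; rewrite -[in LHS]gx homeoVK.
move=> K clK KW [k Kk] gK; apply/seteqP; split=> // x Wx.
apply: contrapT => nKx.
have [||N hN] := minimal_on_hits compactX mg (Y := ~` K).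
- exact: closed_openC.
- by exists x.
have KV n : K ((g ^- n)%g k).
  rewrite -expVgn; elim: n => // n IH; rewrite expgSE; apply: gK.
  by exists (((g^-1) ^+ n)%g k).
have [n nN] := hN _ (KW _ (KV N)); apply.
have -> : (g ^+ n)%g ((g ^- N)%g k) = (g ^- (N - n))%g k.
  apply: (@homeo_injective _ _ (g ^+ (N - n))%g).
  by rewrite -expgDE subnK// !homeoKV.
exact: KV.
Qed.

(** A finite Baire argument: either the last closed set contains the open set, or the others cover
    the nonempty open remainder. *)
Lemma open_finite_closed_cover (n : nat) (F : nat -> set X) (O : set X) :
  (forall i, closed (F i)) -> open O -> O !=set0 ->
  (forall x, O x -> exists2 i, (i < n)%N & F i x) ->
  exists2 i, (i < n)%N & (F i)° !=set0.
Proof.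
move=> cF; elim: n O => [|n IH] O oO [x Ox] cov; first by have [] := cov x Ox.
have [[y [Oy nFy]]|no] := pselect (exists y, O y /\ ~ F n y); last first.
  exists n => //; exists x; apply: filterS (open_nbhs_nbhs (conj oO Ox)) => y Oy.
  by apply: contrapT => nFy; apply: no; exists y.
have [||z [Oz nFz]|i il iF] := IH (O `&` ~` F n).
- by apply: openI => //; exact: closed_openC.
- by exists y.
- have [i] := cov z Oz; rewrite ltnS leq_eqVlt => /predU1P[->//|il] Fz.
  by exists i.
- by exists i => //; exact: ltnW.
Qed.

(** Although [K] need not be invariant, the points whose entire forward orbit lies in [K] form a
    closed forward invariant set containing [x]. *)
Lemma minimal_forward_closed g x K : minimal_on g setT -> closed K ->
  (forall n, K ((g ^+ n)%g x)) -> K = setT.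
Proof.
move=> [_ _ _ gK] cK Kx.
pose K' := \bigcap_n ((g ^+ n)%g @^-1` K).
have K'T : K' = setT.
  apply: gK => //; first by apply: closed_bigI => n _; exact: closed_preimage.
    by exists x => n _; exact: Kx.
  move=> _ [y K'y <-] n _; rewrite /preimage /mkset -expgSrE; exact: K'y.
apply/seteqP; split=> // y _; have : K' y by rewrite K'T.
by move=> /(_ 0 I).
Qed.

(* The cocycle of [h] along an infinite orbit is an injective sequence of
   bounded step, so finitely many [g]-translates of a closed [h]-invariant set
   contain a half orbit of [g]. *)
Lemma aperiodic_interior g h K : minimal g -> free_homeo g ->
  topological_full_group g h -> closed K -> K !=set0 -> h @` K `<=` K ->
  (forall x n, K x -> (0 < n)%N -> (h ^+ n)%g x <> x) -> K° !=set0.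
Proof.
move=> /minimal_minimal_on mg fg [c lc hc] clK [x Kx] hK aper.
have [|M hM] := compact_bounded compactX (Q := fun n y => (`|c y| <= n)%N).
  by move=> y; exists `|c y|%N; apply: filterS (lc y) => z ->.
have {}hM y : (`|c y| <= M)%N by have [n nM /leq_trans] := hM y; apply.
(* The sequence [e] records the position of the [h]-orbit on the [g]-orbit of [x]; its steps are
   values of [c], bounded by [M]. *)
pose e := fix e n : int :=
  if n is n'.+1 then (c ((h ^+ n')%g x) + e n')%R else 0%R.
have eE n : (h ^+ n)%g x = expgz g (e n) x.
  by elim: n => // n IH; rewrite expgSE hc /= expgzDE -IH.
have Khn n : K ((h ^+ n)%g x).
  by elim: n => // n IH; rewrite expgSE; apply: hK; exists ((h ^+ n)%g x).
have lt_e i j : (i < j)%N -> e i <> e j.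
  move=> ij eij; apply: (aper x (j - i)%N) => //; first by rewrite subn_gt0.
  apply: (@homeo_injective _ _ (h ^+ i)%g).
  by rewrite -expgDE subnKC ?(ltnW ij)// !eE eij.
have einj : injective e.
  by move=> i j eij; have [/lt_e|/lt_e|//] := ltngtP i j; rewrite eij.
(* The offset [M] indexes the translates by exponents from [- M] to [M] with natural numbers. *)
pose F i := expgz g (Posz i - Posz M)%R @` K.
have cF i : closed (F i) by rewrite /F image_homeoE; exact: closed_preimage.
have FK (j : int) n : (`|j - e n| <= Posz M)%R ->
    exists2 i, (i < (2 * M).+1)%N & F i (expgz g j x).
  move=> jn; exists `|(j - e n + Posz M)%R|%N; first by lia.
  exists ((h ^+ n)%g x); first exact: Khn.
  by rewrite eE -expgzDE; congr (expgz g _ x); lia.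
pose D := \bigcup_(i in `I_(2 * M).+1) F i.
have cD : closed D by apply: closed_bigcup => //; exact: finite_II.
have DT : D = setT.
  have step n : (`|e n.+1 - e n| <= Posz M)%R.
    by have := hM ((h ^+ n)%g x); rewrite /=; lia.
  have [pos|neg] := injective_bounded_step einj erefl step.
    apply: (minimal_forward_closed (x := x) mg cD) => n.
    by have [//|k /FK[i iM Fi]] := pos (Posz n) _; exists i.
  apply: (minimal_forward_closed (x := x) (minimal_on_inverse mg) cD) => n.
  have [|k /FK[i iM Fi]] := neg (- Posz n)%R _; first by lia.
  by exists i => //; move: Fi; rewrite expgzN expVgn.
have [||y _|i _ [y Fy]] :=
  open_finite_closed_cover (n := (2 * M).+1) (O := setT) cF.
- exact: openT.
- by exists x.
- by have : D y by rewrite DT.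
exists ((expgz g (Posz i - Posz M)%R)^-1%g y).
have : \forall z \near expgz g (Posz i - Posz M)%R
    ((expgz g (Posz i - Posz M)%R)^-1%g y), F i z.
  by rewrite homeoKV.
by move=> /near_homeo; apply: filterS => z [w Kw /homeo_injective <-].
Qed.

(** Unlike in [minimal_on], [K] is only closed and [h] is unrestricted outside it. *)
Definition minimal_set h K := [/\ closed K, K !=set0, h @` K `<=` K &
  forall K', closed K' -> K' `<=` K -> K' !=set0 -> h @` K' `<=` K' -> K' = K].

(** Zorn's lemma is applied to complements, so that chains have unions as bounds. If the union of a
    chain covered [K0], compactness would make a single member cover it; [set0] stands in for a
    member of the empty chain. *)
Lemma exists_minimal_set h K0 : closed K0 -> K0 !=set0 -> h @` K0 `<=` K0 ->
  exists2 K, minimal_set h K & K `<=` K0.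
Proof.
move=> cK0 [x0 Kx0] hK0.
pose P U := [/\ open U, forall x, U (h x) -> U x & exists2 x, K0 x & ~ U x].
have P0 : P set0 by split; [exact: open0| |exists x0].
have [F FP Ftot|U [[oU hU [x Kx nUx]] Umax]] := @Zorn_bigcup X P.
  split.
  - by apply: bigcup_open => U /FP[].
  - by move=> x [U FU Uhx]; exists U => //; have [_ hU _] := FP U FU; exact: hU.
  - apply: contrapT => no.
    have cov x : exists U, nbhs x (U `|` ~` K0) /\ (F U \/ U = set0).
      have [Kx|nKx] := pselect (K0 x); last first.
        exists set0; split; last by right.
        by rewrite set0U; apply: open_nbhs_nbhs; split=> //; exact: closed_openC.
      have [U FU Ux] : (\bigcup_(U in F) U) x.
        by apply: contrapT => nU; apply: no; exists x.
      exists U; split; last by left.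
      have [oU _ _] := FP U FU.
      by apply: filterS (open_nbhs_nbhs (conj oU Ux)) => y; left.
    have [u uP] := choice cov.
    have [s sU] := finite_subcover compactX (fun x => (uP x).1).
    have [V FV sV] : exists2 V, F V \/ V = set0 & forall x, x \in s -> u x `<=` V.
      elim: (s) => [|x t [V FV tV]]; first by exists set0; [right|].
      have [xV|Vx] : u x `<=` V \/ V `<=` u x.
        case: (uP x) => _ [Fux|->]; last by left.
        case: FV => [FV|->]; last by right.
        exact: Ftot.
        exists V => // y; rewrite inE => /predU1P[->//|]; exact: tV.
      exists (u x); first exact: (uP x).2.
      by move=> y; rewrite inE => /predU1P[->//|/tV /subset_trans]; apply.
    have [_ _ [y Ky nVy]] : P V by case: FV => [/FP|->].
    by have [x xs [/(sV _ xs)|]] := sU y.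
exists (K0 `\` U); last by move=> y [].
split.
- by apply: closedI => //; exact: open_closedC.
- by exists x.
- move=> _ [y [Ky nUy] <-]; split; last by move/hU.
  by apply: hK0; exists y.
- move=> K' cK' K'K [y K'y] hK'; apply/seteqP; split=> // z [Kz nUz].
  apply: contrapT => nK'z; apply: (Umax (U `|` ~` K')).
    split; first by move=> w; left.
    by move=> /(_ z) sub; apply: nUz; apply: sub; right.
  split.
  + by apply: openU => //; exact: closed_openC.
  + move=> w [/hU|nK'w]; first by left.
    by right=> K'w; apply: nK'w; apply: hK'; exists w.
  + by exists y; [case: (K'K _ K'y)|case=> // Uy; case: (K'K _ K'y)].
Qed.

Lemma minimal_set_image h K : minimal_set h K -> h @` K = K.
Proof.
move=> [cK [x Kx] hK min]; apply: min => //.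
- by rewrite image_homeoE; exact: closed_preimage.
- by exists (h x); exists x.
- by move=> _ [_ [y Ky <-] <-]; exists (h y) => //; apply: hK; exists y.
Qed.

(** The part of [K] outside its interior is closed and invariant, and proper as the interior is
    nonempty, hence empty. *)
Lemma minimal_set_clopen h K : minimal_set h K -> K° !=set0 -> clopen K.
Proof.
move=> mK [x Kox]; have [cK _ _ min] := mK; split=> //.
have hK := invariant_iff (minimal_set_image mK).
rewrite openE => y Ky; apply: contrapT => nKoy.
have e : K `&` ~` K° = K.
  apply: min.
  - by apply: closedI => //; apply: open_closedC; exact: open_interior.
  - by move=> z [].
  - by exists y.
  - move=> _ [z [Kz nKz] <-]; split; first exact/hK.
    by move=> /near_homeo Khz; apply: nKz; apply: filterS Khz => w /hK.
have : K x by exact: interior_subset Kox.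
by rewrite -e => -[].
Qed.

Lemma minimal_set_eq h K K' x : minimal_set h K -> minimal_set h K' ->
  K x -> K' x -> K = K'.
Proof.
move=> [cK _ hK mK] [cK' _ hK' mK'] Kx K'x.
have cI : closed (K `&` K') by exact: closedI.
have hI : h @` (K `&` K') `<=` K `&` K'.
  by move=> _ [y [Ky K'y] <-]; split; [apply: hK|apply: hK']; exists y.
rewrite -(mK (K `&` K'))//; first by apply: mK' => //; exists x.
by exists x.
Qed.

(** Take a minimal [K] inside the least closed forward invariant set containing [x]. By
    [aperiodic_interior] it is clopen. If [x] were outside, the complement of [K] would be closed,
    invariant and contain [x], hence contain [K]. *)
Lemma minimal_set_through g h Z x : minimal g -> free_homeo g ->
  topological_full_group g h -> closed Z -> h @` Z `<=` Z ->
  (forall y n, Z y -> (0 < n)%N -> (h ^+ n)%g y <> y) -> Z x ->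
  exists K, [/\ minimal_set h K, clopen K, K `<=` Z & K x].
Proof.
move=> mg fg gh cZ hZ aper Zx.
pose I := [set K | [/\ closed K, K x & h @` K `<=` K]].
pose K0 := \bigcap_(K in I) K.
have [|||K mK KK0] := @exists_minimal_set h K0.
- by apply: closed_bigI => K [].
- by exists x => K [].
- move=> _ [y K0y <-] K IK; have [_ _ hK] := IK; apply: hK.
  by exists y => //; exact: K0y.
have KZ : K `<=` Z by move=> y /KK0 /(_ Z); apply.
have [clK [y Ky] hK _] := mK.
have cK : clopen K.
  apply: (minimal_set_clopen mK); apply: (aperiodic_interior mg fg gh) => //.
    by exists y.
  by move=> z n /KZ; exact: aper.
exists K; split=> //; apply: contrapT => nKx.
have : ~ K y; last exact.
apply: (KK0 _ Ky (~` K)); split=> //.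
  by apply: open_closedC; case: cK.
move=> _ [z nKz <-] /(invariant_iff (minimal_set_image mK)).
exact: nKz.
Qed.

End Minimal.

(** * Induced transformations *)

Section Induced.
Variable X : ptopologicalType.
Hypothesis compactX : compact [set: X].
Implicit Types (g h G : homeo X X) (x : X) (A K U W Y : set X).

(** The induced transformation as a homeomorphism of [X], in the same encoding as [minimal_on]. *)
Definition is_induced g A G := (forall x, ~ A x -> G x = x) /\
  forall x, A x -> exists2 t, first_return g A t x & G x = (g ^+ t)%g x.

Lemma first_return_inverse g A t x : A x -> first_return g A t x ->
  first_return (g^-1)%g A t ((g ^+ t)%g x).
Proof.
move=> Ax [t0 At nov]; split=> // [|i i0 it].
  by rewrite expVgn homeoVK.
have -> : ((g^-1) ^+ i)%g ((g ^+ t)%g x) = (g ^+ (t - i))%g x.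
  apply: (@homeo_injective _ _ (g ^+ i)%g).
  by rewrite -expgDE subnKC ?(ltnW it)// expVgn homeoKV.
by apply: nov; lia.
Qed.

(** The first return maps of [g] and [g^-1] are mutually inverse, and continuous because return
    times are locally constant. *)
Lemma induced_exists g A : minimal_on g setT -> clopen A ->
  exists G, is_induced g A G.
Proof.
move=> mg cA.
have ret f : minimal_on f setT -> exists u : X -> X, forall x, A x ->
    exists2 t, first_return f A t x & u x = (f ^+ t)%g x.
  move=> mf; suff /choice[t ht] : forall x, exists t, A x -> first_return f A t x.
    exists (fun x => (f ^+ t x)%g x) => x Ax; exists (t x) => //; exact: ht.
  move=> x; have [Ax|nAx] := pselect (A x); last by exists 0.
  by have [//|t ft] := minimal_on_first_return compactX mf cA.1 _ Ax; exists t.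
have stable f u : (forall x, A x ->
    exists2 t, first_return f A t x & u x = (f ^+ t)%g x) ->
    forall x, A x -> A (u x).
  by move=> uP x /uP[t [_ At _] ->].
have cont f u : (forall x, A x ->
    exists2 t, first_return f A t x & u x = (f ^+ t)%g x) ->
    forall x, A x -> {for x, continuous u}.
  move=> uP x Ax P; have [t ft ->] := uP x Ax => Pt.
  change (\forall y \near x, P (u y)).
  apply: filterS3 (clopen_near x cA) (near_first_return cA ft) (near_homeo Pt).
  move=> y /iffRL /(_ Ax) Ay fty /= Py.
  by have [s fsy ->] := uP y Ay; rewrite (first_return_uniq fsy fty).
have [u uP] := ret g mg; have [v vP] := ret _ (minimal_on_inverse compactX mg).
have uv x : A x -> v (u x) = x.
  move=> Ax; have [t ft e] := uP x Ax.
  have [s fs ->] := vP _ (stable _ _ uP x Ax).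
  rewrite e in fs *; rewrite (first_return_uniq fs (first_return_inverse Ax ft)).
  by rewrite expVgn homeoVK.
have vu x : A x -> u (v x) = x.
  move=> Ax; have [t ft e] := vP x Ax.
  have [s fs ->] := uP _ (stable _ _ vP x Ax).
  have := first_return_inverse Ax ft; rewrite invgK e in fs * => ft'.
  by rewrite (first_return_uniq fs ft') expVgn homeoKV.
have [G [GA _ GN]] := glue_homeo cA (stable _ _ uP) (stable _ _ vP) uv vu
  (cont _ _ uP) (cont _ _ vP).
exists G; split=> // x Ax; have [t ft e] := uP x Ax.
by exists t; rewrite ?GA.
Qed.

Section Properties.
Variables (g G : homeo X X) (A : set X).
Hypotheses (cA : clopen A) (GP : is_induced g A G).

Lemma induced_in x : A x -> A (G x).
Proof. by move=> /GP.2[t [_ At _] ->]. Qed.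

Lemma induced_image : G @` A = A.
Proof.
apply/seteqP; split=> [_ [x /induced_in Ax <-]//|x Ax].
exists ((G^-1)%g x); last exact: homeoKV.
apply: contrapT => nA; apply: nA.
by have [//|nA] := pselect (A ((G^-1)%g x)); have := GP.1 _ nA;
  rewrite homeoKV => {1}<-.
Qed.

(** An induction principle: an orbit segment of [g] with both ends in [A] is a concatenation of
    first returns, that is, of steps of [G]. *)
Lemma return_through_induced x n (P : nat -> X -> Prop) :
  (forall y, A y -> P 0 y) ->
  (forall y t k, A y -> first_return g A t y -> G y = (g ^+ t)%g y ->
    P k (G y) -> P (k + t) y) ->
  A x -> A ((g ^+ n)%g x) -> P n x.
Proof.
move=> P0 PS; elim/ltn_ind: n x => -[|n] IH x Ax An; first exact: P0.
have [t ft Gx] := GP.2 x Ax; have [t0 At nov] := ft.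
have tn : (t <= n.+1)%N.
  by rewrite leqNgt; apply/negP => nt; exact: nov nt An.
rewrite -(subnK tn); apply: PS => //; apply: IH; first by lia.
  exact: induced_in.
by rewrite Gx -expgDE subnK.
Qed.

Lemma germ_induced_expg n x : A x -> A ((g ^+ n)%g x) -> germ G (g ^+ n)%g x.
Proof.
apply: (return_through_induced (P := fun n x => germ G (g ^+ n)%g x)).
  by move=> y _; exact: germ1.
move=> y t k Ay ft Gy Pk; rewrite expgnDr; apply: germM; first by rewrite -Gy.
apply: (@germ_near _ _ G); last exact: germ_refl.
apply: filterS2 (clopen_near y cA) (near_first_return cA ft).
move=> z /iffRL /(_ Ay) Az ftz.
by have [s fsz ->] := GP.2 z Az; rewrite (first_return_uniq fsz ftz).
Qed.

Lemma germ_induced h x : A x -> A (h x) -> germ g h x -> germ G h x.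
Proof.
move=> Ax Ahx [[n|n] hn]; apply: (germ_near hn).
  by apply: germ_induced_expg => //; rewrite -(nbhs_singleton hn).
have hx : h x = (g ^- n.+1)%g x := nbhs_singleton hn.
apply: germV_preimage; apply: germ_induced_expg; first by rewrite -hx.
by rewrite homeoKV.
Qed.

(** The [g]-orbit of a point of [K] would enter the part of [A] outside [K]; but it visits [A] only
    through iterates of [G], which stay in [K]. *)
Lemma induced_minimal_on : minimal_on g setT -> A !=set0 -> minimal_on G A.
Proof.
move=> mg A0; split=> //; first exact: GP.1.
move=> K cK KA [x Kx] GK; apply/seteqP; split=> // y Ay; apply: contrapT => nKy.
have [||N hN] := minimal_on_hits compactX mg (Y := A `&` ~` K).
- by apply: openI; [case: cA|exact: closed_openC].
- by exists y.
have [n _ [An]] := hN x I; have Ax := KA _ Kx; apply; move: Ax An Kx.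
apply: (return_through_induced (P := fun n x => K x -> K ((g ^+ n)%g x))) => //.
move=> z t k Az _ Gz IH Kz; rewrite expgDE -Gz; apply: IH; apply: GK.
by exists z.
Qed.

(** Inducing in stages: between consecutive visits to [A], the [g]-orbit cannot meet the smaller set
    [Y]. *)
Lemma first_return_induced_trans Y x s : Y `<=` A -> A x ->
  first_return G Y s x ->
  exists2 t, first_return g Y t x & (G ^+ s)%g x = (g ^+ t)%g x.
Proof.
move=> YA Ax [s0 Ys nov].
suff [t [t0 e nt]] : exists t, [/\ (0 < t)%N, (G ^+ s)%g x = (g ^+ t)%g x &
    forall i, (0 < i)%N -> (i < t)%N -> ~ Y ((g ^+ i)%g x)].
  by exists t => //; split=> //; rewrite -e.
elim: s x Ax s0 nov {Ys} => // s IH x Ax _ nov.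
have [t [t0 At nt] Gx] := GP.2 x Ax.
have [s0|s0] := posnP s.
  by exists t; rewrite s0 expg1; split=> // i i0 it /YA; exact: nt.
have [|t1 [t10 e nt1]] := IH (G x) (induced_in Ax) s0.
  by move=> i i0 is_; rewrite -expgSrE; apply: nov.
exists (t1 + t)%N; split; first by lia.
  by rewrite expgSrE e expgDE Gx.
move=> i i0 it; have [lt_it|lt_ti|->] := ltngtP i t.
- by move/YA; exact: nt.
- rewrite -(subnK (ltnW lt_ti)) expgDE -Gx; apply: nt1; lia.
- by rewrite -Gx; apply: (nov 1).
Qed.

End Properties.

Lemma nested_homeo (A1 A2 : set X) (Y1 : set A1) (Y2 : set A2) (T : homeo X X) :
  (forall x, (set_val @` Y1) x <-> (set_val @` Y2) (T x)) ->
  exists k : homeo Y1 Y2,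
    forall y, set_val (set_val (k y)) = T (set_val (set_val y)).
Proof.
move=> TY.
have /choice[k kE] : forall y : Y1, exists z : Y2,
    set_val (set_val z) = T (set_val (set_val y)).
  move=> y; have : (set_val @` Y1) (set_val (set_val y)).
    by exists (set_val y) => //; exact: set_valP.
  by move=> /TY[a /set_val_surj[z <-] e]; exists z.
have /choice[l lE] : forall z : Y2, exists y : Y1,
    set_val (set_val y) = (T^-1)%g (set_val (set_val z)).
  move=> z; have : (set_val @` Y2) (T ((T^-1)%g (set_val (set_val z)))).
    by rewrite homeoKV; exists (set_val z) => //; exact: set_valP.
  by move=> /TY[a /set_val_surj[y <-] e]; exists y.
have kK : cancel k l.
  by move=> y; apply/set_val_inj/set_val_inj; rewrite lE kE homeoVK.
have lK : cancel l k.
  by move=> z; apply/set_val_inj/set_val_inj; rewrite kE lE homeoKV.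
have cont (B1 B2 : set X) (Z1 : set B1) (Z2 : set B2) (S : homeo X X)
    (f : Z1 -> Z2) :
    (forall y, set_val (set_val (f y)) = S (set_val (set_val y))) ->
    continuous f.
  move=> fE; do 2![apply: continuous_comp_initial].
  have -> : set_val \o (set_val \o f) = S \o (set_val \o set_val).
    by apply/funext.
  move=> y; apply: continuous_comp; last exact: homeo_fun_continuous.
  by apply: continuous_comp; exact: initial_continuous.
by exists (Homeo kK lK (cont _ _ _ _ _ _ kE) (cont _ _ _ _ _ _ lE)).
Qed.

(** By minimality some power [T] of [g] carries a nonempty clopen part of [A1] into [A2]. As [T]
    commutes with [g], it preserves return times, so it conjugates the maps that [g] induces on this
    part and on its image; inducing in stages compares these with [G1] and [G2]. *)
Lemma induced_kakutani g A1 A2 G1 G2 (e1 : G1 @` A1 = A1) (e2 : G2 @` A2 = A2) :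
  minimal_on g setT -> clopen A1 -> clopen A2 -> A1 !=set0 -> A2 !=set0 ->
  is_induced g A1 G1 -> is_induced g A2 G2 ->
  kakutani_equivalent (restr_homeo e1) (restr_homeo e2).
Proof.
move=> mg cA1 cA2 [x1 A1x] [x2 A2x] GP1 GP2.
have [||N hN] := minimal_on_hits compactX mg (Y := A2).
- by case: cA2.
- by exists x2.
have [n _ A2n] := hN x1 I.
pose T := (g ^+ n)%g.
pose Z1 := A1 `&` T @^-1` A2; pose Z2 := T @` Z1.
have cZ1 : clopen Z1 by apply: clopenI => //; exact: clopen_preimage.
have cZ2 : clopen Z2 by exact: clopen_image.
have Z1A : Z1 `<=` A1 by move=> x [].
have Z2A : Z2 `<=` A2 by move=> _ [x [_ ?] <-].
have Z1x : Z1 x1 by [].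
have [a1 a1x] := set_val_surj A1x; have [a2 a2x] := set_val_surj A2n.
pose Y1 := (set_val : A1 -> X) @^-1` Z1; pose Y2 := (set_val : A2 -> X) @^-1` Z2.
have Y1Z : set_val @` Y1 = Z1 by exact: subtype_image_preimage.
have Y2Z : set_val @` Y2 = Z2 by exact: subtype_image_preimage.
exists Y1, Y2; split.
- exact: clopen_subtype_preimage.
- by exists a1; rewrite /Y1 /preimage /= a1x.
- exact: clopen_subtype_preimage.
- by exists a2; rewrite /Y2 /preimage /= a2x; exists x1.
have [|k kE] := @nested_homeo A1 A2 Y1 Y2 T.
  move=> x; rewrite Y1Z Y2Z; split=> [Zx|[y Zy /homeo_injective <-]//].
  by exists x.
exists k; apply/funext => y; apply/set_val_inj/set_val_inj.
rewrite /= kE.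
have step (A Z : set X) (Y : set A) G (e : G @` A = A) (w : Y) : clopen A ->
    A !=set0 -> clopen Z -> Z `<=` A -> set_val @` Y = Z -> is_induced g A G ->
    exists2 t, first_return g Z t (set_val (set_val w)) &
      set_val (set_val (induced (restr_homeo e) w)) =
        (g ^+ t)%g (set_val (set_val w)).
  move=> cA A0 cZ ZA YZ GP; set x := set_val (set_val w).
  have Zx : Z x by rewrite -YZ; exists (set_val w) => //; exact: set_valP.
  have [s fs] := minimal_on_first_return compactX
    (induced_minimal_on cA GP mg A0) cZ.1 ZA Zx.
  have [t ft Gt] := first_return_induced_trans GP ZA (ZA _ Zx) fs.
  exists t => //; rewrite -YZ in fs.
  have ind := (extends_first_return _ _ _ (restr_extends e)).1 fs.
  rewrite (first_return_induced ind).
  by rewrite -(extends_expg _ _ (restr_extends e)) Gt.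
have [|t ft ->] := step A1 Z1 Y1 G1 e1 y cA1 _ cZ1 Z1A Y1Z GP1.
  by exists x1.
have [|s fs ->] := step A2 Z2 Y2 G2 e2 (k y) cA2 _ cZ2 Z2A Y2Z GP2.
  by exists x2.
rewrite kE in fs *.
have TZ x : Z2 (T x) <-> Z1 x.
  by split=> [[z Zz /homeo_injective <-]//|Zx]; exists x.
have comm i x : (g ^+ i)%g (T x) = T ((g ^+ i)%g x).
  by rewrite /T -!expgDE addnC.
have fs' : first_return g Z1 s (set_val (set_val y)).
  case: fs => s0 Zs nov; split=> //; first by apply/TZ; rewrite -comm.
  by move=> i i0 is_ /TZ; rewrite -comm; exact: nov.
by rewrite (first_return_uniq fs' ft) comm.
Qed.

End Induced.

(** * The decomposition *)

Section Decomposition.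
Variable X : ptopologicalType.
Hypotheses (compactX : compact [set: X]) (hausdorffX : hausdorff_space X).
Implicit Types (g h G : homeo X X) (x : X) (A K Z : set X).

Definition aperiodic_part h :=
  [set x | forall n, (0 < n)%N -> (h ^+ n)%g x <> x].

Lemma aperiodic_partP h x : aperiodic_part h (h x) <-> aperiodic_part h x.
Proof.
split=> ax n n0 e; apply: (ax n n0); first by rewrite -expgSrE expgSE e.
by apply: (@homeo_injective _ _ h); rewrite -expgSE expgSrE e.
Qed.

(** Near a point fixed by [h ^+ n] this power is some [g^m] fixing the point; freeness gives
    [m = 0], so it is the identity there. *)
Lemma full_group_locally_periodic g h : free_homeo g ->
  topological_full_group g h -> locally_periodic h (~` aperiodic_part h).
Proof.
move=> fg gh x nZ; split.
  apply: contrapT => no; apply: nZ => n n0 e; apply: no; by exists n.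
move=> n hx; have [m hm] : germ g (h ^+ n)%g x.
  by apply: germX => i _; exact: full_group_germ.
have m0 : m = 0%R by apply: (fg x); rewrite -(nbhs_singleton hm).
by move: hm; rewrite m0.
Qed.

Lemma closed_aperiodic_part g h : free_homeo g ->
  topological_full_group g h -> closed (aperiodic_part h).
Proof.
move=> fg gh; rewrite -openC openE => x nZ.
have [[p p0 hp] /(_ p hp) hx] := full_group_locally_periodic fg gh nZ.
by apply: filterS hx => y hy /(_ p p0).
Qed.

Lemma minimal_sets_list g h : minimal g -> free_homeo g ->
  topological_full_group g h ->
  exists L : seq (set X), [/\ uniq L,
    forall K, K \in L -> minimal_set h K /\ clopen K,
    forall K, K \in L -> K `<=` aperiodic_part h &
    forall x, aperiodic_part h x -> exists2 K, K \in L & K x].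
Proof.
move=> mg fg gh; set Z := aperiodic_part h.
have cZ : closed Z by exact: closed_aperiodic_part gh.
have hZ : h @` Z `<=` Z by move=> _ [x /aperiodic_partP Zx <-].
have /choice[M MP] : forall x, exists K, Z x ->
    [/\ minimal_set h K, clopen K, K `<=` Z & K x].
  move=> x; have [Zx|nZx] := pselect (Z x); last by exists set0.
  have [|K KP] := minimal_set_through compactX mg fg gh cZ hZ _ Zx.
    by move=> y n Zy; exact: Zy.
  by exists K.
(* Since minimal sets are disjoint or equal and those chosen are clopen, the choice [M] is locally
   constant on [Z]; compactness makes its range finite. *)
pose c x := if pselect (Z x) then Some (M x) else None.
have cE x : Z x -> c x = Some (M x) by rewrite /c; case: pselect.
have lc : locally_constant c.
  move=> x; have [Zx|nZx] := pselect (Z x).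
    have [mM [oM _] MZ Mx] := MP x Zx.
    apply: filterS (open_nbhs_nbhs (conj oM Mx)) => y My.
    have Zy := MZ _ My; have [mMy _ _ Myy] := MP y Zy.
    by rewrite !cE// (minimal_set_eq mM mMy My Myy).
  have : nbhs x (~` Z) by apply: open_nbhs_nbhs; split=> //; exact: closed_openC.
  apply: filterS => y nZy; rewrite /c.
  by case: pselect => //; case: pselect.
have [s [us cs sc]] := locally_constant_range compactX lc.
have LP K : K \in pmap id s <-> exists2 x, Z x & M x = K.
  rewrite mem_pmap map_id; split=> [/sc[x]|[x Zx <-]]; last by rewrite -cE.
  by rewrite /c; case: pselect => // Zx [e]; exists x.
exists (pmap id s); split.
- by apply: (@pmap_uniq _ _ id Some) us; case.
- by move=> K /LP[x Zx <-]; have [] := MP x Zx.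
- by move=> K /LP[x Zx <-]; have [] := MP x Zx.
- move=> x Zx; exists (M x); last by have [] := MP x Zx.
  by apply/LP; exists x.
Qed.

Lemma aperiodic_infinite h A (hA : h @` A = A) : A !=set0 ->
  A `<=` aperiodic_part h -> infinite_set [set: A].
Proof.
move=> [x /set_val_surj[a ax]] AZ fin.
have [|i [j [ij e]]] := @not_injective_nat _ (fun n => (restr_homeo hA ^+ n)%g a).
  exact: sub_finite_set fin.
apply: (AZ (set_val a) (set_valP a) (j - i)%N); first by rewrite subn_gt0.
apply: (@homeo_injective _ _ (h ^+ i)%g).
rewrite -expgDE subnKC ?(ltnW ij)//.
by rewrite !(extends_expg _ _ (restr_extends hA)) e.
Qed.

Lemma restr_compact_minimal G A (GA : G @` A = A) : clopen A -> A !=set0 ->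
  infinite_set [set: A] ->
  (forall K, closed K -> K `<=` A -> K !=set0 -> G @` K `<=` K -> K = A) ->
  compact_minimal_system (restr_homeo GA).
Proof.
move=> cA A0 infA GK; split=> //.
- by apply: subtype_compact; apply: subclosed_compact compactX _ => //; case: cA.
- exact: subtype_hausdorff.
- by apply: extends_minimal_sub => //; case: cA.
Qed.

Lemma full_group_decomposition g h : infinite_set [set: X] -> minimal g ->
  topological_full_group g h ->
  exists (m : nat) (X0 : set X) (Xs : 'I_m -> set X)
         (hX0 : h @` X0 = X0) (hX : forall i, h @` Xs i = Xs i),
    [/\ [/\ X0 `|` \bigcup_i Xs i = [set: X],
            forall i, X0 `&` Xs i = set0 &
            trivIset [set: 'I_m] Xs],
        clopen X0 /\ (forall i, clopen (Xs i)),
        strongly_periodic (restr_homeo hX0),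
        forall i, compact_minimal_system (restr_homeo (hX i)) &
        kakutani_compatible (fun i => restr_homeo (hX i))].
Proof.
move=> infX mg gh; have fg := minimal_free infX hausdorffX mg.
have [L [uL LK LZ ZL]] := minimal_sets_list mg fg gh.
set Z := aperiodic_part h in LZ ZL.
pose Xs (i : 'I_(size L)) := nth set0 L i.
have XL i : Xs i \in L by rewrite mem_nth.
have mX i : minimal_set h (Xs i) by have [] := LK _ (XL i).
have cX i : clopen (Xs i) by have [] := LK _ (XL i).
have X0 i : Xs i !=set0 by case: (mX i).
have ZX : Z = \bigcup_i Xs i.
  apply/seteqP; split=> [x /ZL[K KL Kx]|x [i _ Xx]]; last exact: LZ (XL i) _ Xx.
  have il : (index K L < size L)%N by rewrite index_mem.
  by exists (Ordinal il) => //; rewrite /Xs /= nth_index.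
(* Openness of the aperiodic part is gained only now, from its decomposition into clopen minimal
   sets. *)
have cZ : clopen Z.
  split; last exact: closed_aperiodic_part gh.
  by rewrite ZX; apply: bigcup_open => i _; case: (cX i).
have cZ' : clopen (~` Z) by exact: clopenC set0 cZ.
have hZ' : h @` (~` Z) = ~` Z.
  have hV x : Z ((h^-1)%g x) <-> Z x.
    by have := aperiodic_partP h ((h^-1)%g x); rewrite homeoKV => -[? ?].
  by rewrite image_homeoE; apply/seteqP; split=> x nZ /hV.
have hX i : h @` Xs i = Xs i by exact: minimal_set_image.
have infXs i : infinite_set [set: Xs i].
  by apply: (aperiodic_infinite (hX i)) => //; exact: LZ.
exists (size L), (~` Z), Xs, hZ', hX; split.
- split.
  + by rewrite -ZX setUC setUv.
  + move=> i; apply/seteqP; split=> // x [nZ Xx]; apply: nZ.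
    by rewrite ZX; exists i.
  + move=> i j _ _ [x [Xi Xj]]; apply: val_inj; apply/eqP.
    have /eqP := minimal_set_eq (mX i) (mX j) Xi Xj.
    by rewrite nth_uniq.
- by [].
- apply: local_strongly_periodic => //.
  exact: full_group_locally_periodic gh.
- by move=> i; apply: restr_compact_minimal => //; case: (mX i).
have mgT := (minimal_minimal_on g).1 mg.
(* All components carry transformations induced by the same [g]; these witness Kakutani
   compatibility. *)
have /choice[G GP] : forall i, exists G, is_induced g (Xs i) G.
  by move=> i; exact: induced_exists.
have GX i : G i @` Xs i = Xs i by exact: induced_image (GP i).
have mG i := induced_minimal_on compactX (cX i) (GP i) mgT (X0 i).
have sysG i : compact_minimal_system (restr_homeo (GX i)).
  by apply: restr_compact_minimal => //; case: (mG i).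
exists (fun i => restr_homeo (GX i)); split=> //.
- by move=> i j; apply: (induced_kakutani compactX (GX i) (GX j) mgT).
- move=> i; apply: germ_full_group.
    by have [inf _ haus min] := sysG i; exact: minimal_free.
  move=> a; apply/(extends_germ a (cX i).1 (restr_extends (GX i))
    (restr_extends (hX i))).
  apply: (germ_induced (cX i) (GP i)); [exact: set_valP| |exact: full_group_germ].
  by apply/(invariant_iff (hX i)); exact: set_valP.
Qed.

End Decomposition.

Theorem corollary1p10 (h : homeo cantor_space cantor_space) :
  ppm h <->
  exists (m : nat) (X0 : set cantor_space) (X : 'I_m -> set cantor_space)
         (hX0 : h @` X0 = X0) (hX : forall i, h @` X i = X i),
    [/\ [/\ X0 `|` \bigcup_i X i = [set: cantor_space],
            forall i, X0 `&` X i = set0 &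
            trivIset [set: 'I_m] X],
        clopen X0 /\ (forall i, clopen (X i)),
        strongly_periodic (restr_homeo hX0),
        forall i, compact_minimal_system (restr_homeo (hX i)) &
        kakutani_compatible (fun i => restr_homeo (hX i))].
Proof.
split=> [[C0|[g mg gh]]|].
- by have : [set: cantor_space] point by []; rewrite C0.
- apply: full_group_decomposition mg gh.
  + exact: cantor_space_compact.
  + exact: cantor_space_hausdorff.
  + exact: cantor_infinite.
- move=> [m [X0 [X [hX0 [hX [[cov _ disj] [cX0 cX] hper _ kak]]]]]].
  exact: decomposition_ppm cov disj cX0 cX hper kak.
Qed.
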